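(* Let $B \ge 2$ be a fixed integer. There is a positive constant $c(B)$, depending only on $B$, such that the following holds. For each integer $N \ge 1$ and each real $X \ge 2^N$, let $\mathcal{E}(X,B)$ denote the set of integers $x_0$ with $1 \le x_0 \le X$ for which the iterates $x_k := T^{(k)}(x_0)$, $1\le k\le N$, satisfy $$D\big(\{\log_B x_k : 1 \le k \le N\}\big) > 2N^{-\frac{1}{36}}.$$ Then $$|\mathcal{E}(X,B)| \le c(B)\, N^{-\frac{1}{36}}\, X.$$ In other words, every $x_0\in[1,X]\setminus \mathcal{E}(X,B)$ satisfies $D(\{\log_B x_k: 1\le k\le N\}) \le 2N^{-1/36}$.
   Context: The $3x+1$ function $T:\mathbb{Z}\to\mathbb{Z}$ is defined by $T(n)=\frac{n}{2}$ if $n$ is even and $T(n)=\frac{3n+1}{2}$ if $n$ is odd; $T^{(k)}$ denotes its $k$-th iterate ($T^{(0)}$ is the identity). For positive $x_0$ all iterates are positive integers, so $\log_B x_k$ is defined. For a real number $y$, $\{\{y\}\} := y - \lfloor y \rfloor$ denotes its fractional part. The (normalized) discrepancy of a finite list $\mathcal{Y}=\{y_1,\dots,y_N\}$ of real numbers (repetitions counted) is defined as follows: for $0\le\alpha\le\beta\le 1$ put $Z(\mathcal{Y};\alpha,\beta) := \frac{1}{N}\#\{i : \alpha \le \{\{y_i\}\} \le \beta\}$, and $$D(\mathcal{Y}) := \sup_{0\le \alpha\le\beta\le 1}\big| Z(\mathcal{Y};\alpha,\beta) - (\beta-\alpha)\big|.$$ *)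

(* Defs.v *)
From HB Require Import structures.
From mathcomp Require Import all_boot all_order all_algebra.
From mathcomp Require Import finmap.
From mathcomp Require Import boolp classical_sets functions cardinality.
From mathcomp Require Import reals exp.

Set Implicit Arguments.
Unset Strict Implicit.
Unset Printing Implicit Defensive.

Import Order.TTheory GRing.Theory Num.Theory.

Local Open Scope classical_set_scope.
Local Open Scope ring_scope.

Definition collatzT (n : int) : int :=
  if (2 %| n)%Z then (n %/ 2)%Z else ((3 * n + 1) %/ 2)%Z.

Section Discrepancy.
Variable R : realType.

Definition frac (y : R) : R := y - (Num.floor y)%:~R.

(* Lists are sequences, so repeated values are counted with multiplicity. *)
Definition prop_in (Y : seq R) (alpha beta : R) : R :=
  (count (fun y => alpha <= frac y <= beta) Y)%:R / (size Y)%:R.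

Definition deviations (Y : seq R) : set R :=
  [set d | exists alpha beta : R, [/\ 0 <= alpha, alpha <= beta, beta <= 1
    & d = `|prop_in Y alpha beta - (beta - alpha)|]].

Definition discrepancy (Y : seq R) : R := sup (deviations Y).

(* [sup] is 0 on sets without a supremum; that case does not occur here. *)
Lemma has_sup_deviations (Y : seq R) : has_sup (deviations Y).
Proof.
split; first by exists `|prop_in Y 0 0 - (0 - 0)|, 0, 0; split.
exists 1 => _ [a [b [a0 ab b1 ->]]].
have /andP[p0 p1] : 0 <= prop_in Y a b <= 1.
  rewrite /prop_in divr_ge0//=; case: (posnP (size Y)) => [->|Y0].
    by rewrite invr0 mulr0.
  by rewrite ler_pdivrMr ?ltr0n// mul1r ler_nat count_size.
rewrite ler_norml; apply/andP; split.
  rewrite lerBrDr; apply: le_trans p0.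
  by rewrite addrC subr_le0 lerBlDr (le_trans b1)// lerDl.
rewrite lerBlDr; apply: (le_trans p1).
by rewrite lerDl subr_ge0.
Qed.

Definition logB (B : nat) (x : R) : R := ln x / ln B%:R.

Definition log_iterates (B N : nat) (x0 : int) : seq R :=
  [seq logB B (iter k collatzT x0)%:~R | k <- iota 1 N].

Definition exceptional (B N : nat) (X : R) : set int :=
  [set x0 | [/\ 1 <= x0, x0%:~R <= X &
    discrepancy (log_iterates B N x0) > 2 * N%:R `^ (- (1 / 36))]].

(* [fset_set] is the empty finite set on infinite sets; that case does not
   occur for [exceptional]. *)
Lemma finite_exceptional (B N : nat) (X : R) : finite_set (exceptional B N X).
Proof.
apply: (@sub_finite_set _ _ (Posz @` `I_(`|Num.floor X|.+1))); last first.
  exact/finite_image/finite_II.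
move=> [n|n] [] //= _ nX _; exists n => //=.
rewrite ltnS -lez_nat.
have : (Posz n <= Num.floor X)%R by rewrite floor_ge_int.
by move=> /le_trans; apply; rewrite abszE ler_norm.
Qed.

End Discrepancy.

(* Main.v *)
Require Import Defs.
From HB Require Import structures.
From Stdlib Require BinInt Zbool.
From mathcomp Require Import all_boot all_order all_algebra.
From mathcomp Require Import finmap.
From mathcomp Require Import zify ssrZ ring lra.
From mathcomp Require Import boolp classical_sets functions cardinality.
From mathcomp Require Import reals topology normedtype sequences derive.
From mathcomp Require Import realfun exp trigo.

(** For [x0] in a block of [2^N] consecutive integers the parities of the first
   [N] iterates run once through all of [{0,1}^N], so up to a negligible error
   [log_B x_k] is [log_B x_0] plus a random walk with steps [- log_B 2] and
   [log_B (3/2)].  Its [j]-th Weyl sum has second moment [O(N / |1 - phi_j|)],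
   where [phi_j] is the Fourier coefficient of a step, and [1 - Re phi_j] is the
   sum of the squared distances (up to constants) of [j log_B 2] and
   [j log_B (3/2)] to the integers.  Eliminating [log B] between these two
   approximations leaves a linear form in [log 2] and [log 3], bounded below by
   [c j^-16]; the Erdos-Turan inequality with [J ~ N^(1/36)] and Chebyshev's
   inequality conclude.

   The linear form [u1 log (3/2) + u2 log (4/3)] is bounded below by the
   simultaneous approximations
   [int t^(j-7n) ((t-2)^6 (t-3)^7 (t-4)^4)^n dt/t] over [2,3] and [3,4]; the
   exponents make [lcm(1, ..., 10n+2)] a common denominator, which is at most
   [C 3.03^n]. *)

Set Implicit Arguments.
Unset Strict Implicit.
Unset Printing Implicit Defensive.

Import Order.TTheory GRing.Theory Num.Theory numFieldNormedType.Exports.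

Local Open Scope classical_set_scope.
Local Open Scope ring_scope.

(** The exponent 36 is 2 * 16 + 4. Squared distances turn j^-16 into a gap 1 - Re phi_j of order
    j^-32; with nu = N^(1/36) and J of order nu, the second moments of the J frequencies cost nu^2
    J^33 / N, which is of order nu^-1. The 16 is log be / log (1 / al), about 15.8, rounded up,
    where al^n and be^n are the sizes of the integrals and of the coefficient of the linear form
    once the common denominator is multiplied in. Integrality yields a bound only if the rational
    part of the approximation is nonzero; this is known for one of the three shifts j = 0, 1, 2, not
    for a given one. Two points make the walk usable. The mean error caused by the 1 in 3x + 1 is of
    order (4/3)^N / x_0, so the x_0 below 2^N / N are discarded, at most X / N of them. And log_B
    x_0 varies inside a block, but it only rotates the Weyl sum of the walk, whose modulus depends
    on the parity vector alone. *)

Section LcmNat.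
Local Open Scope nat_scope.

(** * Exponential upper bound for lcm(1, ..., n) *)

Definition lcm_upto (n : nat) : nat := \big[lcmn/1%N]_(1 <= i < n.+1) i.

Lemma lcm_upto_gt0 n : 0 < lcm_upto n.
Proof.
rewrite /lcm_upto big_nat_cond; apply: (big_ind (fun x => 0 < x)) => //.
- by move=> x y x0 y0; rewrite lcmn_gt0 x0.
- by move=> i /andP[/andP[]].
Qed.

Lemma dvdn_lcm_upto n i : 0 < i -> i <= n -> i %| lcm_upto n.
Proof.
move=> i0 iln; rewrite /lcm_upto (bigD1_seq i) /= ?iota_uniq ?dvdn_lcml//.
by rewrite mem_index_iota i0.
Qed.

Lemma logn_lcm_upto p n : prime p -> logn p (lcm_upto n) = \sum_(1 <= k < n.+1) (p ^ k <= n).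
Proof.
move=> pp; have p1 := prime_gt1 pp.
have -> : \sum_(1 <= k < n.+1) (p ^ k <= n) = trunc_log p n.
  have [->|n0] := posnP n; first by rewrite trunc_log0 big_nil.
  have tn : trunc_log p n <= n.
    have := trunc_logP p1 n0; apply: leq_trans; apply: ltnW.
    exact: ltn_expl.
  rewrite (@big_cat_nat _ _ _ (trunc_log p n).+1) //=.
  rewrite [X in _ + X]big1_seq ?addn0; last first.
    move=> k; rewrite mem_index_iota => /andP[_ /andP[kt _]].
    apply/eqP; rewrite eqb0 -ltnNge.
    by apply: leq_trans (trunc_log_ltn n p1) _; rewrite leq_exp2l.
  rewrite (eq_big_nat _ _ (F2 := fun=> 1%N)); last first.
    move=> k /andP[_ kt]; apply/eqP; rewrite eqb1.
    by apply: leq_trans (trunc_logP p1 n0); rewrite leq_exp2l.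
  by rewrite sum_nat_const_nat subn1 muln1.
have [->|n0] := posnP n.
  by rewrite trunc_log0 /lcm_upto big_nil logn1.
apply/eqP; rewrite eqn_leq; apply/andP; split.
  rewrite /lcm_upto big_nat_cond.
  pose Q x := (0 < x) && (logn p x <= trunc_log p n).
  suff /andP[] : Q (\big[lcmn/1]_(1 <= i < n.+1 | (0 < i < n.+1) && true) i) by [].
  apply: (big_ind Q); rewrite /Q ?logn1//.
    move=> x y /andP[x0 xt] /andP[y0 yt]; rewrite lcmn_gt0 x0 y0 /=.
    by rewrite logn_lcm// geq_max xt.
  move=> i /andP[/andP[i0 iln] _]; rewrite i0 /=.
  apply: trunc_log_max => //.
  exact: leq_trans (dvdn_leq i0 (pfactor_dvdnn p i)) _.
rewrite -pfactor_dvdn ?lcm_upto_gt0//; apply: dvdn_lcm_upto.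
  by rewrite expn_gt0 prime_gt0.
exact: trunc_logP.
Qed.

(** Since 1/2 + 1/3 + 1/7 + 1/42 = 1, the four floors add up to [x] only if 42 divides [x]. For 0 <
    x < 42 there is thus room for the 1 on the left, and from 42 on the right side has its own 1. *)
Lemma sum_floor_le x : (0 < x) + (x %/ 2 + x %/ 3 + x %/ 7 + x %/ 42) <= x + (42 <= x).
Proof. lia. Qed.

Lemma dvdn_of_logn m n : 0 < m -> 0 < n ->
  (forall p, prime p -> logn p m <= logn p n) -> m %| n.
Proof.
move=> m0 n0 H; apply/dvdn_partP => // p; rewrite mem_primes => /andP[pp _].
by rewrite p_part pfactor_dvdn// H.
Qed.

(** Chebyshev's method: for each prime power [p ^ k] the contributions to the two valuations are the
    two sides of [sum_floor_le] at [x = n %/ p ^ k]. *)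
Lemma lcm_upto_dvd n :
  lcm_upto n * ((n %/ 2)`! * (n %/ 3)`! * (n %/ 7)`! * (n %/ 42)`!)
    %| n`! * lcm_upto (n %/ 42).
Proof.
have fg k : 0 < k`! by exact: fact_gt0.
have lg k := lcm_upto_gt0 k.
apply: dvdn_of_logn => [||p pp]; rewrite ?muln_gt0 ?fg ?lg//.
rewrite !lognM ?muln_gt0 ?fg ?lg// !logn_lcm_upto// !logn_fact//.
have p0 := prime_gt0 pp; have p1 := prime_gt1 pp.
have ext a : 0 < a ->
    \sum_(1 <= k < (n %/ a).+1) n %/ a %/ p ^ k = \sum_(1 <= k < n.+1) n %/ p ^ k %/ a.
  move=> a0; rewrite [RHS](@big_cat_nat _ _ _ (n %/ a).+1)//=; last first.
    by rewrite ltnS leq_div.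
  rewrite [X in _ = _ + X]big1_seq ?addn0.
    by apply: eq_bigr => k _; rewrite -!divnMA mulnC.
  move=> k; rewrite mem_index_iota => /andP[_ /andP[ak _]].
  rewrite -divnMA mulnC divnMA divn_small//; apply: leq_trans ak _.
  exact: ltnW (ltn_expl _ _).
have ext2 : \sum_(1 <= k < (n %/ 42).+1) (p ^ k <= n %/ 42) =
    \sum_(1 <= k < n.+1) (42 <= n %/ p ^ k).
  rewrite [RHS](@big_cat_nat _ _ _ (n %/ 42).+1)//=; last first.
    by rewrite ltnS leq_div.
  rewrite [X in _ = _ + X]big1_seq ?addn0.
    apply: eq_bigr => k _; congr nat_of_bool.
    by rewrite !leq_divRL// ?expn_gt0 ?p0// mulnC.
  move=> k; rewrite mem_index_iota => /andP[_ /andP[ak _]].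
  apply/eqP; rewrite eqb0 -ltnNge ltn_divLR ?expn_gt0 ?p0//.
  rewrite mulnC -ltn_divLR//; apply: leq_trans ak _.
  exact: ltnW (ltn_expl _ _).
rewrite !ext// ext2 -!big_split/=; apply: leq_sum => k _.
apply: leq_trans (sum_floor_le (n %/ p ^ k)).
by rewrite divn_gt0 ?expn_gt0 ?p0.
Qed.

End LcmNat.

Section LcmBound.
Variable R : realType.
Implicit Types x y : R.

(** One term of the expansion of (x + y)^(m + n) is at most the whole sum. *)
Lemma fact_binomial_bound x y m n : 0 < x -> 0 < y ->
  (m + n)`!%:R <= ((x + y) / x) ^+ m * ((x + y) / y) ^+ n * (m`!%:R * n`!%:R).
Proof.
move=> x0 y0.
have xy : 0 < x + y by rewrite addr_gt0.
have mn : (m <= m + n)%N by exact: leq_addr.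
have := bin_fact mn; rewrite addKn => <-.
rewrite natrM natrM ler_wpM2r ?mulr_ge0//.
rewrite !expr_div_n mulrACA -invfM -exprD ler_pdivlMr ?mulr_gt0 ?exprn_gt0//.
rewrite (addrC x y) exprDn (bigD1 (inord m)) //= inordK ?ltnS ?leq_addr//.
rewrite addKn mulrC (mulrC (x ^+ m)) mulr_natr lerDl sumr_ge0// => i _.
by rewrite mulrn_wge0// mulr_ge0 ?exprn_ge0 ?ltW.
Qed.

Lemma fact_multinomial_bound k1 k2 k3 k4 :
  ((k1 + k2 + k3 + k4)%N`!)%:R <=
  2 ^+ k1 * 3 ^+ k2 * 7 ^+ k3 * 42 ^+ k4 *
  (k1`!%:R * k2`!%:R * k3`!%:R * k4`!%:R) :> R.
Proof.
(* The weights 21, 14, 6, 1 are 42 times 1/2, 1/3, 1/7, 1/42; the parts are merged one after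
   another. *)
have h1 := @fact_binomial_bound 21 14 k1 k2 ltac:(lra) ltac:(lra).
have h2 := @fact_binomial_bound 35 6 (k1 + k2) k3 ltac:(lra) ltac:(lra).
have h3 := @fact_binomial_bound 41 1 (k1 + k2 + k3) k4 ltac:(lra) ltac:(lra).
apply: le_trans h3 _.
pose c3 : R := ((41 + 1) / 41) ^+ (k1 + k2 + k3) * ((41 + 1) / 1) ^+ k4.
pose c2 : R := ((35 + 6) / 35) ^+ (k1 + k2) * ((35 + 6) / 6) ^+ k3.
pose c1 : R := ((21 + 14) / 21) ^+ k1 * ((21 + 14) / 14) ^+ k2.
have c30 : 0 <= c3 by rewrite mulr_ge0// exprn_ge0//; lra.
have c20 : 0 <= c2 by rewrite mulr_ge0// exprn_ge0//; lra.
apply: (@le_trans _ _ (c3 * ((c2 * ((c1 * (k1`!%:R * k2`!%:R)) * k3`!%:R)) * k4`!%:R))).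
  rewrite ler_wpM2l// ler_wpM2r//; apply: (le_trans h2).
  by rewrite ler_wpM2l// ler_wpM2r.
rewrite le_eqVlt; apply/orP; left; apply/eqP.
have -> : 2 = ((41 + 1) / 41) * ((35 + 6) / 35) * ((21 + 14) / 21) :> R by field; lra.
have -> : 3 = ((41 + 1) / 41) * ((35 + 6) / 35) * ((21 + 14) / 14) :> R by field; lra.
have -> : 7 = ((41 + 1) / 41) * ((35 + 6) / 6) :> R by field; lra.
have -> : 42 = (41 + 1) / 1 :> R by field; lra.
rewrite /c1 /c2 /c3 !exprD !exprMn; ring.
Qed.

Lemma bernoulli_ge (h : R) n : -1 <= h -> 1 + n%:R * h <= (1 + h) ^+ n.
Proof.
move=> h1; elim: n => [|n IH]; first by rewrite mul0r addr0 expr0.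
rewrite exprS; apply: le_trans (ler_wpM2l _ IH); last by lra.
rewrite -natr1; have : 0 <= n%:R * h ^+ 2 by rewrite mulr_ge0// sqr_ge0.
by rewrite expr2; lra.
Qed.

(** Bernoulli twice: for [h = (1 - x) / (k + 1)] and [y = 1 - h] it gives x <= y^(k + 1), and also n
    y^n <= 1 / h because (1 + h) (1 - h) <= 1. Then raise the second bound to the power k + 1. *)
Lemma natX_geom_bounded (x : R) k : 0 <= x -> x < 1 ->
  exists2 C : R, 0 < C & forall n, n%:R ^+ k * x ^+ n <= C.
Proof.
move=> x0 x1.
pose h := (1 - x) / k.+1%:R.
have k0 : 0 < k.+1%:R :> R by rewrite ltr0n.
have h0 : 0 < h by rewrite divr_gt0// subr_gt0.
have h1 : h <= 1.
  rewrite ler_pdivrMr// mul1r -natr1; have : 0 <= k%:R :> R by []; lra.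
pose y := 1 - h.
have y0 : 0 <= y by rewrite subr_ge0.
have xy : x <= y ^+ k.+1.
  have := @bernoulli_ge (- h) k.+1; rewrite lerN2 => /(_ h1); apply: le_trans.
  by rewrite mulrN /h mulrC divfK ?gt_eqF//; lra.
have ny n : n%:R * y ^+ n <= h^-1.
  rewrite -[leRHS]mul1r ler_pdivlMr//.
  have := @bernoulli_ge h n ltac:(lra) => B.
  apply: (@le_trans _ _ ((1 + h) ^+ n * y ^+ n)).
    by rewrite mulrAC ler_wpM2r ?exprn_ge0//; lra.
  rewrite -exprMn; apply: exprn_ile1; rewrite /y; nra.
exists (Num.max 1 h^-1 ^+ k.+1); first by rewrite exprn_gt0// lt_max ltr01.
case=> [|n].
  rewrite expr0 mulr1 (@le_trans _ _ 1)//; first by case: (k) => [|k'] //; rewrite expr0n.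
  by rewrite exprn_ege1// le_max lexx.
apply: (@le_trans _ _ ((n.+1%:R * y ^+ n.+1) ^+ k.+1)).
  rewrite exprMn ler_pM ?exprn_ge0//.
    by rewrite exprS ler_peMl ?exprn_ge0// ler1n.
  by rewrite -exprM mulnC exprM lerXn2r// nnegrE ?exprn_ge0.
by rewrite lerXn2r ?nnegrE ?mulr_ge0 ?exprn_ge0// ?le_max ?ler01// ny orbT.
Qed.

Lemma fact_leM n d : ((n + d)`! <= (n + d) ^ d * n`!)%N.
Proof.
elim: d => [|d IH]; first by rewrite addn0 mul1n.
rewrite addnS factS expnS -mulnA leq_mul2l; apply/orP; right.
apply: leq_trans IH _; rewrite leq_mul2r; apply/orP; right.
by case: d => [|d]; rewrite ?expn0// leq_exp2r.
Qed.

(** The base 2.945 lies just above 2^(1/2) 3^(1/3) 7^(1/7) 42^(1/42), about 2.944; [n ^ 4] pays for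
    the rounding in the four quotients. *)
Lemma lcm_upto_rec n : (0 < n)%N ->
  (lcm_upto n)%:R <= n%:R ^+ 4 * (2945 / 1000) ^+ n * (lcm_upto (n %/ 42))%:R :> R.
Proof.
move=> n0.
set k1 := (n %/ 2)%N; set k2 := (n %/ 3)%N; set k3 := (n %/ 7)%N; set k4 := (n %/ 42)%N.
pose s := (k1 + k2 + k3 + k4)%N.
have [d dE d4] : exists2 d, n = (s + d)%N & (d <= 4)%N by exists (n - s)%N; lia.
pose F : R := k1`!%:R * k2`!%:R * k3`!%:R * k4`!%:R.
have F0 : 0 < F by rewrite !mulr_gt0// ltr0n fact_gt0.
rewrite -(ler_pM2r F0).
apply: (@le_trans _ _ (n`! * lcm_upto k4)%:R).
  rewrite /F -!natrM ler_nat; apply: dvdn_leq; last exact: lcm_upto_dvd.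
  by rewrite muln_gt0 fact_gt0 lcm_upto_gt0.
rewrite natrM mulrAC ler_wpM2r//.
apply: (@le_trans _ _ (n%:R ^+ 4 * s`!%:R)).
  rewrite -natrX -natrM ler_nat dE; apply: leq_trans (fact_leM _ _) _.
  by rewrite leq_mul2r leq_pexp2l ?orbT// -dE.
rewrite -[leRHS]mulrA ler_wpM2l ?exprn_ge0//.
apply: le_trans (fact_multinomial_bound _ _ _ _) _.
rewrite ler_wpM2r ?(ltW F0)//.
(* The 42nd power clears the roots: the numerical claim becomes 2^21 3^14 7^6 42 <= 2.945^42. *)
rewrite -(@ler_pXn2r _ 42)//; [|by rewrite nnegrE !mulr_ge0 ?exprn_ge0|
  by rewrite nnegrE exprn_ge0//; lra].
rewrite [leRHS]exprAC.
apply: (@le_trans _ _ (2 ^+ (21 * n) * 3 ^+ (14 * n) * 7 ^+ (6 * n) * 42 ^+ n)).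
  rewrite !exprMn -!exprM.
  do 3 (try (apply: ler_pM; rewrite ?mulr_ge0 ?exprn_ge0//));
    rewrite ler_weXn2l ?ler1n//; lia.
by rewrite !exprM -!exprMn lerXn2r ?nnegrE ?exprn_ge0//; lra.
Qed.

Lemma leq_lcm_upto m n : (m <= n)%N -> (lcm_upto m <= lcm_upto n)%N.
Proof.
move=> mn; apply: dvdn_leq; first exact: lcm_upto_gt0.
rewrite [X in (X %| _)%N]/lcm_upto big_nat_cond.
elim/big_ind: _ => //.
  by move=> x y xd yd; rewrite dvdn_lcm xd.
move=> i /andP[/andP[i0 im] _]; apply: dvdn_lcm_upto => //.
by rewrite ltnS in im; exact: leq_trans im mn.
Qed.

Lemma lcm_upto_le :
  exists2 C : R, 0 < C & forall n, (lcm_upto n)%:R <= C * (303 / 100) ^+ n.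
Proof.
(* The recursion contributes r^(n / 42), and 3.03^(1/42) < 1.027. Since 2.945 * 1.027 < 3.03,
   [x < 1] and x^n absorbs n^4. The fifth power in place of the fourth leaves a spare [n], which
   beats [C] beyond [n0]. *)
pose r : R := 303 / 100; pose x : R := 2945 / 1000 * (1027 / 1000) / r.
have [C C0 HC] := @natX_geom_bounded x 5 ltac:(rewrite /x/r; lra) ltac:(rewrite /x/r; lra).
have [n0 Cn0] : exists n0 : nat, C < n0%:R.
  by exists (Num.truncn C).+1; apply: truncnS_gt.
have r1 : 1 <= r by rewrite /r; lra.
exists (lcm_upto n0)%:R; first by rewrite ltr0n lcm_upto_gt0.
move=> n; elim/ltn_ind: n => n IH.
have [nn0|n0n] := leqP n n0.
  apply: (@le_trans _ _ (lcm_upto n0)%:R); first by rewrite ler_nat leq_lcm_upto.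
  by rewrite ler_peMr// exprn_ege1.
have npos : (0 < n)%N by apply: leq_trans n0n.
apply: le_trans (lcm_upto_rec npos) _.
have nlt : (n %/ 42 < n)%N by rewrite ltn_Pdiv.
apply: (@le_trans _ _ (n%:R ^+ 4 * (2945 / 1000) ^+ n * ((lcm_upto n0)%:R * (1027 / 1000) ^+ n))).
  rewrite ler_wpM2l ?mulr_ge0 ?exprn_ge0//; first by lra.
  apply: le_trans (IH _ nlt) _; rewrite ler_wpM2l//.
  apply: (@le_trans _ _ ((1027 / 1000) ^+ (42 * (n %/ 42)))).
    by rewrite exprM lerXn2r ?nnegrE//; lra.
  by rewrite ler_weXn2l; [|lra|lia].
rewrite mulrCA ler_wpM2l//.
have n1 : 0 < n%:R :> R by rewrite ltr0n.
rewrite -(ler_pM2l n1).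
have -> : n%:R * (n%:R ^+ 4 * (2945 / 1000) ^+ n * (1027 / 1000) ^+ n) =
    (n%:R ^+ 5 * x ^+ n) * r ^+ n.
  rewrite -[RHS]mulrA -exprMn divfK; last by rewrite /r; lra.
  set a := 2945 / 1000; set b := 1027 / 1000.
  by rewrite (exprMn n a b) (exprS _ 4) !mulrA.
rewrite ler_wpM2r ?exprn_ge0//; first by rewrite (le_trans ler01).
apply: (le_trans (HC n)); apply: (le_trans (ltW Cn0)).
by rewrite ler_nat ltnW.
Qed.
End LcmBound.

(** * Primitives of Laurent polynomials, stripped of their logarithm *)

Lemma is_derive_MVT (R : realType) (f df : R -> R) (a b : R) : a < b ->
  (forall x : R, is_derive x 1 f (df x)) ->
  exists2 c, a < c < b & f b - f a = df c * (b - a).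
Proof.
move=> ab fdf.
have fc : {within `[a, b], continuous f}.
  by apply: derivable_within_continuous => x _; exact: ex_derive.
have [c cab ->] := MVT ab (fun x _ => fdf x) fc.
by exists c => //; move: cab; rewrite in_itv.
Qed.

Section LaurentPrimitive.
Variables (R : realType) (m : nat).
Implicit Types (P Q : {poly R}) (a b c : R).

(* The antiderivative of [P(t) / t^(m+1)] without its logarithmic term: the
   summand [i = m] vanishes because the inverse of 0 is 0. *)
Definition lprim P a : R :=
  \sum_(i < size P) P`_i * (a ^+ i / a ^+ m / (i%:R - m%:R)).

Lemma lprim_wide n P a : (size P <= n)%N ->
  lprim P a = \sum_(i < n) P`_i * (a ^+ i / a ^+ m / (i%:R - m%:R)).
Proof.
move=> sPn; rewrite /lprim (big_ord_widen n
  (fun i => P`_i * (a ^+ i / a ^+ m / (i%:R - m%:R))) sPn) big_mkcond/=.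
by apply: eq_bigr => i _; case: ltnP => // si; rewrite nth_default// mul0r.
Qed.

Lemma lprimD P Q a : lprim (P + Q) a = lprim P a + lprim Q a.
Proof.
pose n := maxn (size P) (size Q).
rewrite !(@lprim_wide n) ?leq_maxl ?leq_maxr ?size_polyD// -big_split/=.
by apply: eq_bigr => i _; rewrite coefD mulrDl.
Qed.

Lemma lprimZ (k : R) P a : lprim (k *: P) a = k * lprim P a.
Proof.
rewrite (@lprim_wide (size P)) ?size_scale_leq// mulr_sumr.
by apply: eq_bigr => i _; rewrite coefZ -[LHS]mulrA.
Qed.

(** (X P' - m P) / t^(m+1) is the derivative of P / t^m, so there is no logarithm. The constant
    appears because [lprim] drops the term of degree [m]; it cancels in differences. *)
Lemma lprim_euler P a : a != 0 ->
  lprim ('X * P^`() - m%:R *: P) a = P.[a] / a ^+ m - P`_m.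
Proof.
move=> a0; pose n := maxn (size P).+1 m.+1.
have sn : (size P <= n)%N by rewrite leq_max leqnSn.
rewrite (@lprim_wide n); last first.
  apply: leq_trans (size_polyD _ _) _; rewrite geq_max size_polyN.
  apply/andP; split; last by apply: leq_trans (size_scale_leq _ _) _.
  rewrite (leq_trans (size_polyMleq _ _))// size_polyX /=.
  rewrite (leq_trans _ (leq_maxl _ _))// ltnS.
  exact: leq_trans (size_poly _ _) (leq_pred _).
rewrite (horner_coef_wide _ sn) mulr_suml.
have mn : (m < n)%N by rewrite leq_max leqnn orbT.
rewrite (bigD1 (Ordinal mn))//= [in RHS](bigD1 (Ordinal mn))//=.
rewrite subrr invr0 !mulr0 add0r mulfK ?expf_neq0// addrAC subrr add0r.
apply: eq_bigr => i /eqP im.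
have im0 : (i%:R - m%:R : R) != 0.
  rewrite subr_eq0 eqr_nat; apply/eqP => E; apply: im; exact: val_inj.
rewrite coefB coefZ coefXM coef_deriv.
case: ifP => [/eqP i0|/negbT i0].
  by move: im0; rewrite i0 !sub0r => im0; field; rewrite expf_neq0//= -oppr_eq0.
by rewrite prednK ?lt0n// -mulr_natl; field; rewrite im0 expf_neq0.
Qed.

(** The left side is the integral of P(t) / t^m against dt / t over [a, b], a measure of mass ln b -
    ln a. Under t = e^x the primitive is a linear term plus exponentials, and the ordinary mean
    value theorem applies. *)
Lemma lprim_MVT P a b : 0 < a -> a < b ->
  exists2 c, a < c < b & lprim P b - lprim P a + P`_m * (ln b - ln a) =
    (ln b - ln a) * (P.[c] / c ^+ m).
Proof.
move=> a0 ab; have b0 := lt_trans a0 ab.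
pose h (i : 'I_(size P)) (x : R) : R :=
  if i == m :> nat then P`_i * x
  else P`_i / (i%:R - m%:R) * expR ((i%:R - m%:R) * x).
pose f : R -> R := \sum_(i < size P) h i.
pose df (x : R) : R := \sum_(i < size P) P`_i * expR ((i%:R - m%:R) * x).
have dh (i : 'I_(size P)) (x : R) : is_derive x 1 (h i) (P`_i * expR ((i%:R - m%:R) * x)).
  rewrite /h; case: eqP => [->|/eqP im].
    rewrite subrr mul0r expR0 mulr1.
    by apply: is_derive_eq; rewrite /GRing.scale/= mulr1.
  have im0 : (i%:R - m%:R : R) != 0 by rewrite subr_eq0 eqr_nat.
  by apply: is_derive_eq; rewrite /GRing.scale/=; field.
have expM (i : nat) x : expR ((i%:R - m%:R) * x) = expR x ^+ i / expR x ^+ m :> R.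
  by rewrite mulrBl expRB !expRM_natl.
have df_f (x : R) : is_derive x 1 f (df x) by exact: is_derive_sum.
have dfE x : df x = P.[expR x] / expR x ^+ m.
  rewrite horner_coef mulr_suml; apply: eq_bigr => i _.
  by rewrite expM mulrA.
have fE x : f x = lprim P (expR x) + P`_m * x.
  rewrite /f fct_sumE.
  have -> : P`_m * x = \sum_(i < size P) (if i == m :> nat then P`_i * x else 0).
    rewrite -big_mkcond/=; have [sm|ms] := leqP (size P) m.
      rewrite nth_default// mul0r big_pred0// => i.
      by apply/negbTE; rewrite neq_ltn (leq_trans (ltn_ord i) sm).
    by rewrite (big_pred1 (Ordinal ms)).
  rewrite /lprim -big_split/=; apply: eq_bigr => i _; rewrite /h -expM.
  case: eqP => [->|_]; first by rewrite subrr invr0 !mulr0 add0r.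
  by rewrite addr0 mulrAC mulrA.
have ln_ab : ln a < ln b by rewrite ltr_ln ?posrE.
have [c /andP[ac cb] E] := is_derive_MVT ln_ab df_f.
exists (expR c).
  have ea : expR (ln a) = a by rewrite lnK ?posrE.
  have eb : expR (ln b) = b by rewrite lnK ?posrE.
  by rewrite -ea -eb !ltr_expR ac cb.
move: E; rewrite dfE !fE !lnK ?posrE// => E.
by rewrite [RHS]mulrC -E; ring.
Qed.

End LaurentPrimitive.

(** * Nonvanishing of one of three consecutive approximations *)

Section NonVanishing.
Variables (R : realType) (m n : nat) (u1 u2 : R).
Implicit Types (P Q S : {poly R}).

(** Rational part of u1 times the integral over [2, 3] plus u2 times the one over [3, 4]: what
    remains is the coefficient of degree [m] times u1 log (3/2) + u2 log (4/3). *)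
Definition lform P : R :=
  u1 * (lprim m P 3 - lprim m P 2) + u2 * (lprim m P 4 - lprim m P 3).

Lemma lformD P Q : lform (P + Q) = lform P + lform Q.
Proof. by rewrite /lform !lprimD; ring. Qed.

Lemma lformZ (k : R) P : lform (k *: P) = k * lform P.
Proof. by rewrite /lform !lprimZ; ring. Qed.

Lemma lform_euler P : P.[2] = 0 -> P.[3] = 0 -> P.[4] = 0 ->
  lform ('X * P^`() - m%:R *: P) = 0.
Proof.
move=> P2 P3 P4; rewrite /lform !lprim_euler ?pnatr_eq0// P2 P3 P4; ring.
Qed.

Definition hpoly : {poly R} := ('X - 2%:P) ^+ 6 * ('X - 3%:P) ^+ 7 * ('X - 4%:P) ^+ 4.
Definition cpoly : {poly R} := ('X - 2%:P) * ('X - 3%:P) * ('X - 4%:P).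

Lemma hpolyE x : hpoly.[x] = (x - 2) ^+ 6 * (x - 3) ^+ 7 * (x - 4) ^+ 4.
Proof. by rewrite /hpoly 2!hornerM !horner_exp !hornerXsubC. Qed.

Lemma hpolyX_deriv :
  cpoly * (hpoly ^+ n)^`() =
  n%:R * (17 * 'X ^+ 2 - 104 * 'X + 152) * hpoly ^+ n.
Proof.
have h' : cpoly * hpoly^`() = (17 * 'X ^+ 2 - 104 * 'X + 152) * hpoly.
  have -> : 17 * 'X ^+ 2 - 104 * 'X + 152 = 6 * (('X - 3%:P) * ('X - 4%:P))
      + 7 * (('X - 2%:P) * ('X - 4%:P)) + 4 * (('X - 2%:P) * ('X - 3%:P)) :> {poly R}.
    by rewrite !polyC_natr; ring.
  rewrite /cpoly /hpoly derivM derivM !deriv_exp !derivXsubC /= !mul1r.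
  move: ('X - 2%:P) ('X - 3%:P) ('X - 4%:P) => a b c.
  by rewrite (exprS a 5) (exprS b 6) (exprS c 3); move: (a ^+ 5) (b ^+ 6) (c ^+ 3); intros; ring.
rewrite deriv_exp -mulr_natl; case: n => [|k]; first by rewrite !mul0r mulr0.
by rewrite /= mulrCA (mulrA cpoly) h' (exprS hpoly); move: (hpoly ^+ k) => Y; ring.
Qed.

(** This is [lform_euler] at X^i h^n [cpoly], which vanishes at 2, 3 and 4. The factor [cpoly] makes
    the derivative of h^n again a multiple of h^n, so only four consecutive shifts occur. *)
Lemma lform_rec i : let k : R := i%:R - m%:R in
  (k + 3 + 17 * n%:R) * lform ('X^(i + 3) * hpoly ^+ n) =
  (9 * k + 18 + 104 * n%:R) * lform ('X^(i + 2) * hpoly ^+ n)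
  - (26 * k + 26 + 152 * n%:R) * lform ('X^(i + 1) * hpoly ^+ n)
  + 24 * k * lform ('X^i * hpoly ^+ n).
Proof.
move=> k.
have c2 : cpoly.[2] = 0 by rewrite /cpoly !hornerE; ring.
have c3 : cpoly.[3] = 0 by rewrite /cpoly !hornerE; ring.
have c4 : cpoly.[4] = 0 by rewrite /cpoly !hornerE; ring.
pose B := 'X^i * hpoly ^+ n * cpoly.
have B2 : B.[2] = 0 by rewrite hornerM c2 mulr0.
have B3 : B.[3] = 0 by rewrite hornerM c3 mulr0.
have B4 : B.[4] = 0 by rewrite hornerM c4 mulr0.
have := lform_euler B2 B3 B4.
have -> : 'X * B^`() - m%:R *: B =
    (k + 3 + 17 * n%:R) *: ('X^(i + 3) * hpoly ^+ n)
    + (- (9 * k + 18 + 104 * n%:R)) *: ('X^(i + 2) * hpoly ^+ n)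
    + (26 * k + 26 + 152 * n%:R) *: ('X^(i + 1) * hpoly ^+ n)
    + (- (24 * k)) *: ('X^i * hpoly ^+ n).
  have c' : cpoly^`() = 3 * 'X ^+ 2 - 18 * 'X + 26.
    rewrite /cpoly !derivM !derivXsubC.
    have -> : 2%:P = 2 :> {poly R} by rewrite polyC_natr.
    have -> : 3%:P = 3 :> {poly R} by rewrite polyC_natr.
    have -> : 4%:P = 4 :> {poly R} by rewrite polyC_natr.
    ring.
  have cE : cpoly = 'X ^+ 3 - 9 * 'X ^+ 2 + 26 * 'X - 24.
    rewrite /cpoly.
    have -> : 2%:P = 2 :> {poly R} by rewrite polyC_natr.
    have -> : 3%:P = 3 :> {poly R} by rewrite polyC_natr.
    have -> : 4%:P = 4 :> {poly R} by rewrite polyC_natr.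
    ring.
  have E1 : 'X * ('X^i)^`() = i%:R * 'X^i :> {poly R}.
    rewrite derivXn -mulr_natl mulrCA; case: (i) => [|j]; first by rewrite !mul0r.
    by rewrite /= -exprS.
  have -> : 'X * B^`() = ('X * ('X^i)^`()) * hpoly ^+ n * cpoly
      + 'X * 'X^i * (cpoly * (hpoly ^+ n)^`()) + 'X * 'X^i * hpoly ^+ n * cpoly^`().
    by rewrite /B !derivM; ring.
  rewrite E1 hpolyX_deriv c' /B cE -!mul_polyC /k.
  rewrite ?(polyCD, polyCN, polyCM, polyC_natr, polyCB) !exprD.
  move: ('X^i) (hpoly ^+ n) => Y Z; ring.
rewrite !lformD !lformZ => E.
by apply/eqP; rewrite -subr_eq0 -E; apply/eqP; ring.
Qed.

(** The leading coefficient i - m + 3 + 17 n of [lform_rec] is positive by the hypothesis on [m], so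
    three zeros propagate to all shifts and, by linearity, to every multiple of h^n. *)
Lemma lform_hpolyX_eq0 S : (m < 17 * n + 3)%N ->
  (forall j, (j < 3)%N -> lform ('X^j * hpoly ^+ n) = 0) ->
  lform (S * hpoly ^+ n) = 0.
Proof.
move=> mn h0.
have hX i : lform ('X^i * hpoly ^+ n) = 0.
  elim/ltn_ind: i => i IH.
  have [/h0//|i3] := ltnP i 3.
  have := lform_rec (i - 3).
  rewrite /= (_ : (i - 3 + 3)%N = i) ?subnK//.
  rewrite (IH (i - 3 + 2)%N) ?(IH (i - 3 + 1)%N) ?(IH (i - 3)%N); [|lia..].
  rewrite !mulr0 subr0 addr0 => /eqP; rewrite mulf_eq0 => /orP[|/eqP//].
  have : m%:R < 17 * n%:R + 3 + (i - 3)%N%:R :> R.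
    by rewrite -natrM -!natrD ltr_nat; lia.
  by move=> ? /eqP ?; lra.
rewrite -[S]coefK poly_def.
elim: (size S) => [|k IH].
  by rewrite big_ord0 mul0r; have := lformZ 0 0; rewrite scale0r mul0r.
by rewrite big_ord_recr/= mulrDl lformD IH -scalerAl lformZ hX mulr0 addr0.
Qed.

(** Otherwise the form vanishes on all multiples of h^n, among them t^(m+1) S h^(2n), whose
    integrals have known signs for S = 1 and S = t - 3. These give two linear equations for u1, u2
    with a positive determinant. *)
Lemma lform_neq0 : (m < 17 * n + 3)%N -> (u1 != 0) || (u2 != 0) ->
  exists2 j, (j < 3)%N & lform ('X^j * hpoly ^+ n) != 0.
Proof.
move=> mn u0; apply/not_exists2P => H.
have h0 j : (j < 3)%N -> lform ('X^j * hpoly ^+ n) = 0.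
  by move=> j3; have := H j; case=> [//|/negP/negPn/eqP].
have hpos (x : R) : 2 < x < 4 -> x != 3 -> 0 < (hpoly ^+ n).[x] ^+ 2.
  move=> /andP[x2 x4] x3; rewrite exprn_even_gt0//= horner_exp expf_neq0//.
  rewrite hpolyE; apply: mulf_neq0; [apply: mulf_neq0|]; apply: expf_neq0;
    by rewrite subr_eq0 ?(gt_eqF x2) ?(lt_eqF x4).
have hsgn S : exists2 z : R * R, (2 < z.1 < 3) && (3 < z.2 < 4) &
    u1 * (ln 3 - ln 2) * (S.[z.1] * (hpoly ^+ n).[z.1] ^+ 2) * z.1 +
    u2 * (ln 4 - ln 3) * (S.[z.2] * (hpoly ^+ n).[z.2] ^+ 2) * z.2 = 0.
  (* The factor X^(m+1) kills the coefficient of degree [m], hence the logarithms: the form is now a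
     combination of two integrals. *)
  have E0 := lform_hpolyX_eq0 ('X^(m.+1) * S * hpoly ^+ n) mn h0.
  have := @lprim_MVT R m ('X^(m.+1) * S * hpoly ^+ n * hpoly ^+ n) 2 3.
  case=> [||x xi Ex]; [lra..|].
  have := @lprim_MVT R m ('X^(m.+1) * S * hpoly ^+ n * hpoly ^+ n) 3 4.
  case=> [||y yi Ey]; [lra..|].
  have c0 : ('X^(m.+1) * S * hpoly ^+ n * hpoly ^+ n)`_m = 0.
    by rewrite -!mulrA coefXnM ltnSn.
  rewrite c0 mul0r addr0 in Ex; rewrite c0 mul0r addr0 in Ey.
  exists (x, y); first by rewrite /= xi yi.
  move: E0; rewrite /lform Ex Ey /= !hornerM !hornerXn.
  have x0 : x != 0 by apply/eqP => x0; move: xi; rewrite x0; lra.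
  have y0 : y != 0 by apply/eqP => y0; move: yi; rewrite y0; lra.
  move=> <-; rewrite !exprS; field.
  by rewrite !expf_neq0.
have l1 : 0 < ln 3 - ln 2 :> R by rewrite subr_gt0 ltr_ln ?posrE; lra.
have l2 : 0 < ln 4 - ln 3 :> R by rewrite subr_gt0 ltr_ln ?posrE; lra.
have [[x y]/= /andP[/andP[x2 x3] /andP[y3 y4]]] := hsgn 1%:P.
have [[x' y']/= /andP[/andP[x2' x3'] /andP[y3' y4']]] := hsgn ('X - 3%:P).
rewrite !hornerXsubC !hornerC.
have hx := hpos x ltac:(apply/andP; split; lra) ltac:(lra).
have hy := hpos y ltac:(apply/andP; split; lra) ltac:(lra).
have hx' := hpos x' ltac:(apply/andP; split; lra) ltac:(lra).
have hy' := hpos y' ltac:(apply/andP; split; lra) ltac:(lra).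
move: ((hpoly ^+ n).[x] ^+ 2) ((hpoly ^+ n).[y] ^+ 2) hx hy => X Y hx hy.
move: ((hpoly ^+ n).[x'] ^+ 2) ((hpoly ^+ n).[y'] ^+ 2) hx' hy' => X' Y' hx' hy'.
move=> E' E.
have x0 : 0 < x by rewrite (lt_trans _ x2).
have y0 : 0 < y by rewrite (lt_trans _ y3).
have x0' : 0 < x' by rewrite (lt_trans _ x2').
have y0' : 0 < y' by rewrite (lt_trans _ y3').
have d1 : 0 < 3 - x' by rewrite subr_gt0.
have d2 : 0 < y' - 3 by rewrite subr_gt0.
have a1 : 0 < (ln 3 - ln 2) * X * x by rewrite !mulr_gt0.
have a2 : 0 < (ln 4 - ln 3) * Y * y by rewrite !mulr_gt0.
have b1 : 0 < (ln 3 - ln 2) * ((3 - x') * X') * x' by rewrite !mulr_gt0.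
have b2 : 0 < (ln 4 - ln 3) * ((y' - 3) * Y') * y' by rewrite !mulr_gt0.
set A1 := (X in 0 < X) in a1; set A2 := (X in 0 < X) in a2.
set B1 := (X in 0 < X) in b1; set B2 := (X in 0 < X) in b2.
have E1 : u1 * A1 + u2 * A2 = 0 by rewrite -[RHS]E /A1 /A2; ring.
have E2 : u2 * B2 - u1 * B1 = 0 by rewrite -[RHS]E' /B1 /B2; ring.
have D : 0 < A1 * B2 + A2 * B1 by rewrite addr_gt0// mulr_gt0.
have u10 : u1 * (A1 * B2 + A2 * B1) = 0.
  have -> : u1 * (A1 * B2 + A2 * B1) = (u1 * A1 + u2 * A2) * B2 - (u2 * B2 - u1 * B1) * A2 by ring.
  by rewrite E1 E2 !mul0r subrr.
have u20 : u2 * (A1 * B2 + A2 * B1) = 0.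
  have -> : u2 * (A1 * B2 + A2 * B1) = (u1 * A1 + u2 * A2) * B1 + (u2 * B2 - u1 * B1) * A1 by ring.
  by rewrite E1 E2 !mul0r addr0.
move: u0; rewrite -negb_and => /negP; apply.
move/eqP: u10; rewrite mulf_eq0 (gt_eqF D) orbF => ->.
by move/eqP: u20; rewrite mulf_eq0 (gt_eqF D) orbF.
Qed.
End NonVanishing.

(** * Numerical bound for |h(t)| / t^7 on (2, 4) *)

Definition cellZ (k x : BinNums.Z) : bool :=
  BinInt.Z.leb ((k + 1) ^+ 6 * x ^+ 7 * (400 - k) ^+ 4 * 10 ^+ 7)
    (19 * 200 ^+ 10 * (k + 400) ^+ 7).

(** The interval is cut into cells [2 + k/200, 2 + (k+1)/200). On each, every factor of h is
    replaced by its largest absolute value and t by its least value, and powers of 200 are cleared;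
    the second argument is 200 times the maximum of |t - 3|. Binary integers make this
    computable. *)
Lemma cellZP : all (fun k : nat =>
    cellZ (BinInt.Z.of_nat k) (if (k < 200)%N then 200 - BinInt.Z.of_nat k
                        else BinInt.Z.of_nat k - 199)) (iota 0 400).
Proof. by vm_compute. Qed.

(** Used for both maps out of [int]: to the binary integers, where the inequality is computed, and
    to the reals, where it is needed. *)
Lemma rmorph_cell (A B : comPzRingType) (f : {rmorphism A -> B}) (k x : A) :
  f ((k + 1) ^+ 6 * x ^+ 7 * (400 - k) ^+ 4 * 10 ^+ 7) =
    (f k + 1) ^+ 6 * f x ^+ 7 * (400 - f k) ^+ 4 * 10 ^+ 7
  /\ f (19 * 200 ^+ 10 * (k + 400) ^+ 7) = 19 * 200 ^+ 10 * (f k + 400) ^+ 7.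
Proof.
rewrite -(rmorph_nat f 400) -(rmorph_nat f 10) -(rmorph_nat f 19) -(rmorph_nat f 200).
move: (400%:R) (10%:R) (19%:R) (200%:R) => a b c d.
by split; [rewrite 3!rmorphM 4!rmorphXn rmorphD rmorphB rmorph1
          |rewrite 2!rmorphM 2!rmorphXn rmorphD].
Qed.

Lemma Z_of_int_le (a b : int) :
  BinInt.Z.leb (Z_of_int a) (Z_of_int b) -> a <= b.
Proof. by move=> /Zbool.Zle_is_le_bool; lia. Qed.

Lemma cellZ_int (k x : int) : cellZ (Z_of_int k) (Z_of_int x) ->
  (k + 1) ^+ 6 * x ^+ 7 * (400 - k) ^+ 4 * 10 ^+ 7 <= 19 * 200 ^+ 10 * (k + 400) ^+ 7.
Proof.
have [E1 E2] := rmorph_cell Z_of_int k x.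
rewrite /cellZ -E1 -E2 {E1 E2}.
exact: Z_of_int_le.
Qed.

Section Bounds.
Variable R : realType.

Lemma cell_bound (k : nat) : (k < 400)%N ->
  (k%:R + 1) ^+ 6 * (if (k < 200)%N then 200 - k%:R else k%:R - 199) ^+ 7
    * (400 - k%:R) ^+ 4 * 10 ^+ 7 <= 19 * 200 ^+ 10 * (k%:R + 400) ^+ 7 :> R.
Proof.
move=> k4; have := cellZP; move=> /allP /(_ k); rewrite mem_iota => /(_ k4).
have -> : BinInt.Z.of_nat k = ssrZ.Z_of_int k%:Z by [].
have -> : (if (k < 200)%N then 200 - ssrZ.Z_of_int k%:Z else ssrZ.Z_of_int k%:Z - 199)
    = ssrZ.Z_of_int (if (k < 200)%N then 200 - k%:Z else k%:Z - 199).
  by case: ifP => _; rewrite rmorphB rmorph_nat.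
move=> /cellZ_int.
set x := (if _ then _ else _); rewrite -(ler_int R).
have [-> ->] := rmorph_cell (intr : {rmorphism int -> R}) k%:Z x.
suff -> : (if (k < 200)%N then 200 - k%:R else k%:R - 199) = x%:~R :> R by [].
by rewrite /x; case: ifP => _; rewrite rmorphB /= rmorph_nat.
Qed.

Lemma hpoly_sup (t : R) : 2 < t < 4 -> `|(hpoly R).[t]| / t ^+ 7 <= 19 / 10 ^+ 7.
Proof.
move=> /andP[t2 t4].
pose y := 200 * t - 400; have y0 : 0 <= y by rewrite /y; lra.
pose k := Num.truncn y.
have /andP[ky yk] : k%:R <= y < k.+1%:R by exact: truncn_itv.
have k4 : (k < 400)%N by rewrite -(ltr_nat R); apply: le_lt_trans ky _; rewrite /y; lra.
have tp : 0 < t by lra.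
have := cell_bound k4; set mx := (if _ then _ else _) => cb.
rewrite ler_pdivrMr ?exprn_gt0// hpolyE 2!normrM 3!normrX.
have tE : t = (y + 400) / 200 by rewrite /y; field.
have kr : k.+1%:R = k%:R + 1 :> R by rewrite natr1.
rewrite kr in yk.
have t3 : `|t - 3| <= mx / 200.
  rewrite tE ler_norml /mx; case: ltnP => k2.
    have : k%:R + 1 <= 200 :> R by rewrite natr1 ler_nat. 
    by move=> ?; apply/andP; split; lra.
  have : 200 <= k%:R :> R by rewrite ler_nat.
  by move=> ?; apply/andP; split; lra.
have h2 : `|t - 2| <= (k%:R + 1) / 200 by rewrite ger0_norm; lra.
have h4 : `|t - 4| <= (400 - k%:R) / 200 by rewrite ler0_norm; lra.
have t7 : (k%:R + 400) / 200 <= t by lra.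
have mx0 : 0 <= mx / 200 := le_trans (normr_ge0 _) t3.
apply: (@le_trans _ _ (((k%:R + 1) / 200) ^+ 6 * (mx / 200) ^+ 7 * ((400 - k%:R) / 200) ^+ 4)).
  have X (u v : R) e : `|u| <= v -> `|u| ^+ e <= v ^+ e.
    by move=> uv; rewrite lerXn2r ?nnegrE ?(le_trans _ uv).
  have := X _ _ 6%N h2; have := X _ _ 7%N t3; have := X _ _ 4%N h4.
  have := exprn_ge0 6 (normr_ge0 (t - 2)); have := exprn_ge0 7 (normr_ge0 (t - 3)).
  have := exprn_ge0 4 (normr_ge0 (t - 4)).
  move: (_ ^+ 4) (_ ^+ 7) (_ ^+ 6) (_ ^+ 4) (_ ^+ 7) (_ ^+ 6) => a b c a' b' c'.
  by move=> *; rewrite !ler_pM ?mulr_ge0.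
apply: (@le_trans _ _ (19 / 10 ^+ 7 * ((k%:R + 400) / 200) ^+ 7)); last first.
  apply: ler_wpM2l; first by rewrite divr_ge0// exprn_ge0.
  by apply: lerXn2r; rewrite ?nnegrE ?divr_ge0 ?addr_ge0// ltW.
move: cb; move: (k%:R) mx {mx0 t3} => K mx.
rewrite !expr_div_n => cb.
have -> : (K + 1) ^+ 6 / 200 ^+ 6 * (mx ^+ 7 / 200 ^+ 7) * ((400 - K) ^+ 4 / 200 ^+ 4) =
  ((K + 1) ^+ 6 * mx ^+ 7 * (400 - K) ^+ 4 * 10 ^+ 7) / (200 ^+ 10 * 200 ^+ 7 * 10 ^+ 7).
  move: ((K + 1) ^+ 6) (mx ^+ 7) ((400 - K) ^+ 4) => u v w.
  by field.
rewrite ler_pdivrMr; last by rewrite !mulr_gt0// exprn_gt0.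
apply: (le_trans cb).
move: ((K + 400) ^+ 7) => u.
by rewrite le_eqVlt; apply/orP; left; apply/eqP; field.
Qed.
End Bounds.

(** * Size of the coefficients of h^n *)

Section Majorant.
Variable R : realType.
Implicit Types P Q : {poly R}.

Definition majorant P Q := forall i, `|P`_i| <= Q`_i.

Lemma majorantM P P' Q Q' :
  majorant P P' -> majorant Q Q' -> majorant (P * Q) (P' * Q').
Proof.
move=> hP hQ i; rewrite !coefM (le_trans (ler_norm_sum _ _ _))// ler_sum// => j _.
by rewrite normrM ler_pM.
Qed.

Lemma majorantX P Q n : majorant P Q -> majorant (P ^+ n) (Q ^+ n).
Proof.
move=> h; elim: n => [|n IH]; last by rewrite !exprS; exact: majorantM.
by rewrite !expr0 => i; rewrite coef1; case: eqP; rewrite ?normr1 ?normr0.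
Qed.

Lemma majorant_XsubC (c : R) : 0 <= c -> majorant ('X - c%:P) ('X + c%:P).
Proof.
move=> c0 i; rewrite coefB coefD coefX coefC.
by case: i => [|[|i]] /=; rewrite ?sub0r ?add0r ?subr0 ?addr0 ?normrN ?normr1 ?normr0 ?ger0_norm.
Qed.

(** Cauchy's estimate: all terms of Q(r) are nonnegative, and the one of index [i] suffices. *)
Lemma majorant_coef_le P Q (r : R) i : 0 < r -> majorant P Q ->
  `|P`_i| * r ^+ i <= Q.[r].
Proof.
move=> r0 h; have Q0 k : 0 <= Q`_k := le_trans (normr_ge0 _) (h k).
have [si|si] := leqP (size Q) i.
  have := h i; rewrite (nth_default _ si) normr_le0 => /eqP ->.
  rewrite normr0 mul0r.
  by rewrite horner_coef sumr_ge0// => k _; rewrite mulr_ge0 ?exprn_ge0 ?(ltW r0).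
rewrite horner_coef (bigD1 (Ordinal si))//= -[leLHS]addr0 lerD//.
  by rewrite ler_wpM2r ?exprn_ge0 ?(ltW r0).
by rewrite sumr_ge0// => k _; rewrite mulr_ge0 ?exprn_ge0 ?(ltW r0).
Qed.

(** The majorant of h is (t + 2)^6 (t + 3)^7 (t + 4)^4, evaluated at 2. This radius is close to the
    minimiser of the majorant over t^7, the quantity that governs the coefficients of index near
    7n. *)
Lemma hpolyX_coef_le n k :
  `|(hpoly R ^+ n)`_k| * 2 ^+ k <= (4 ^+ 6 * 5 ^+ 7 * 6 ^+ 4) ^+ n.
Proof.
pose H : {poly R} := ('X + 2%:P) ^+ 6 * ('X + 3%:P) ^+ 7 * ('X + 4%:P) ^+ 4.
have HM : majorant (hpoly R) H.
  apply: majorantM; [apply: majorantM|]; apply: majorantX;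
    by apply: majorant_XsubC.
have := majorant_coef_le k (ltr0Sn R 1) (majorantX n HM).
rewrite horner_exp /H 2!hornerM !horner_exp !hornerD !hornerX !hornerC.
by rewrite -!natrD.
Qed.

End Majorant.

(** * Common denominator of the approximations *)

Section Integrality.

(** Divisibility by [d] of the polynomial P(aX), a property that is multiplicative in [d] and
    [P]. *)
Definition wdvd (a d : int) (P : {poly int}) := forall i, (d %| P`_i * a ^+ i)%Z.

Lemma wdvdM a d e P Q : wdvd a d P -> wdvd a e Q -> wdvd a (d * e) (P * Q).
Proof.
move=> hP hQ i; rewrite coefM mulr_suml; apply: rpred_sum => j _.
have -> : P`_j * Q`_(i - j) * a ^+ i = (P`_j * a ^+ j) * (Q`_(i - j) * a ^+ (i - j)).
  by rewrite mulrACA -exprD subnKC// -ltnS.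
exact: dvdz_mul.
Qed.

Lemma wdvdX a d P n : wdvd a d P -> wdvd a (d ^+ n) (P ^+ n).
Proof.
move=> h; elim: n => [|n IH]; last by rewrite !exprS; exact: wdvdM.
by move=> i; rewrite expr0 dvd1z.
Qed.

Lemma wdvd_XsubC a d c : (d %| a)%Z -> (d %| c)%Z -> wdvd a d ('X - c%:P).
Proof.
move=> da dc i; rewrite coefB coefX coefC.
case: i => [|[|i]] /=.
- by rewrite sub0r expr0 mulr1 rpredN.
- by rewrite subr0 mul1r expr1.
- by rewrite subr0 mul0r dvdz0.
Qed.

Definition hpolyZ : {poly int} := ('X - 2%:P) ^+ 6 * ('X - 3%:P) ^+ 7 * ('X - 4%:P) ^+ 4.

(** The contents visible in h(aX) are 2^6 2^4 for a = 2, 3^7 for a = 3 and 2^6 4^4 = 4^7 for a = 4.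
    So a^7 divides in every case, which cancels the denominators a^(7n) in the primitive. *)
Lemma hpolyZ_wdvd n (a : nat) : a \in [:: 2; 3; 4]%N ->
  wdvd a (a%:Z ^+ (7 * n)) (hpolyZ ^+ n).
Proof.
suff h : forall a : nat, a \in [:: 2; 3; 4]%N -> wdvd a (a%:Z ^+ 7) hpolyZ.
  by move=> /h; rewrite exprM; exact: wdvdX.
have tr (b d e : int) P : (d %| e)%Z -> wdvd b e P -> wdvd b d P.
  by move=> de h i; exact: dvdz_trans de (h i).
have w1 (b : int) c k : wdvd b 1 (('X - c%:P) ^+ k) by move=> i; rewrite dvd1z.
move=> b; rewrite !inE => /or3P[]/eqP ->.
- apply: (@tr _ _ (2 ^+ 6 * 1 * 2 ^+ 4)); first by [].
  apply: wdvdM; last by apply/wdvdX/wdvd_XsubC.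
  by apply: wdvdM => //; apply/wdvdX/wdvd_XsubC.
- apply: (@tr _ _ (1 * 3 ^+ 7 * 1)); first by [].
  apply: wdvdM => //.
  by apply: wdvdM => //; apply/wdvdX/wdvd_XsubC.
- apply: (@tr _ _ (2 ^+ 6 * 1 * 4 ^+ 4)); first by [].
  apply: wdvdM; last by apply/wdvdX/wdvd_XsubC.
  by apply: wdvdM => //; apply/wdvdX/wdvd_XsubC.
Qed.

Variable R : realType.

Lemma hpolyZE n : hpoly R ^+ n = map_poly intr (hpolyZ ^+ n).
Proof.
rewrite rmorphXn /hpolyZ /=; congr (_ ^+ n).
rewrite 2!rmorphM 3!rmorphXn !rmorphB /= !map_polyX !map_polyC.
by rewrite /hpoly.
Qed.

Lemma size_hpolyX n : (size (hpoly R ^+ n) <= 17 * n + 1)%N.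
Proof.
have s : (size (hpoly R) <= 18)%N.
  have sz (c : R) k : size (('X - c%:P) ^+ k) = k.+1 by exact: size_exp_XsubC.
  have s1 : (size (('X - 2%:P) ^+ 6 * ('X - 3%:P) ^+ 7 : {poly R})%R <= 14)%N.
    by apply: leq_trans (size_polyMleq _ _) _; rewrite !sz.
  apply: leq_trans (size_polyMleq _ _) _; rewrite sz addnS /=.
  exact: leq_add s1 (leqnn 4).
apply: leq_trans (size_poly_exp_leq _ _) _; nia.
Qed.

Lemma lcm_upto_div_int N (k : R) : k \is a Num.int -> `|k| <= N%:R ->
  (lcm_upto N)%:R / k \is a Num.int.
Proof.
(* The quotient by 0 is 0; this is the term that [lprim] drops. *)
move=> /intrP[z ->]; have [->|z0] := eqVneq z 0.
  by rewrite invr0 mulr0 rpred0.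
rewrite -intr_norm -[N%:R]/(N%:Z%:~R) ler_int => zN.
have : (`|z| %| lcm_upto N)%N.
  by apply: dvdn_lcm_upto; rewrite ?absz_gt0// -lez_nat abszE.
move=> /dvdnP[q ->]; rewrite natrM.
have -> : (`|z|%N)%:R = `|z%:~R : R| by rewrite -intr_norm -abszE.
rewrite -mulrA; apply: rpredM; first exact: natr_int.
have [zp|zn] := ger0P (z%:~R : R).
  by rewrite divff ?intr_eq0// rpred1.
by rewrite mulNr divff ?intr_eq0// rpredN rpred1.
Qed.

(** The divisors i - 7n that come from integration lie between -7n and 10n + 2, so the lcm clears
    them; [hpolyZ_wdvd] clears the powers of [a]. *)
Lemma lcm_lprim_int n j (a : nat) : (j < 3)%N -> a \in [:: 2; 3; 4]%N ->
  (lcm_upto (10 * n + 2))%:R * lprim (7 * n) ('X^j * hpoly R ^+ n) a%:R \is a Num.int.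
Proof.
move=> j3 a234; have a0 : a%:R != 0 :> R by rewrite pnatr_eq0; case: a a234.
rewrite /lprim mulr_sumr; apply: rpred_sum => i _.
rewrite coefXnM; case: ltnP => ij; first by rewrite mul0r mulr0 rpred0.
have iB : (i <= 17 * n + 2)%N.
  rewrite -ltnS; apply: leq_trans (ltn_ord i) _.
  apply: leq_trans (size_polyMleq _ _) _; rewrite size_polyXn.
  have := size_hpolyX n; lia.
move: (nat_of_ord i) ij iB => {}i ij iB; rewrite hpolyZE coef_map.
have /dvdzP[z zE] := hpolyZ_wdvd n a234 (i - j)%N.
have -> : (lcm_upto (10 * n + 2))%:R * (((hpolyZ ^+ n)`_(i - j)%N)%:~R *
    (a%:R ^+ i / a%:R ^+ (7 * n) / (i%:R - (7 * n)%N%:R))) =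
    z%:~R * a%:R ^+ j * ((lcm_upto (10 * n + 2))%:R / (i%:R - (7 * n)%N%:R)) :> R.
  have -> : z%:~R * a%:R ^+ j = ((hpolyZ ^+ n)`_(i - j)%N)%:~R * a%:R ^+ i / a%:R ^+ (7 * n) :> R.
    apply: (mulIf (expf_neq0 (7 * n) a0)); rewrite divfK ?expf_neq0//.
    rewrite -{2}(subnKC ij) exprD.
    move: zE => /(congr1 (intr : int -> R)); rewrite !rmorphM !rmorphXn /=.
    rewrite -!pmulrn => zE.
    by rewrite mulrAC -zE; ring.
  ring.
apply: rpredM; first by apply: rpredM; rewrite ?rpredX ?intr_int ?natr_int.
apply: lcm_upto_div_int; first by rewrite rpredB ?natr_int.
have h1 : (7 * n)%N%:R <= (10 * n + 2)%N%:R :> R by rewrite ler_nat; lia.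
have h2 : i%:R <= (10 * n + 2)%N%:R + (7 * n)%N%:R :> R.
  by rewrite -natrD ler_nat; lia.
have h3 : 0 <= i%:R :> R by [].
by rewrite ler_norml; apply/andP; split; lra.
Qed.
End Integrality.

(** * Lower bound for the linear form u1 log (3/2) + u2 log (4/3) *)

Lemma log_form_key (R : realType) (C rho mu q al be : R) (u1 u2 : int) (H : R) n :
  0 < C -> 0 < rho -> 0 <= mu -> 0 <= q ->
  (forall k, (lcm_upto k)%:R <= C * rho ^+ k) ->
  (forall t : R, 2 < t < 4 -> `|(hpoly R).[t]| / t ^+ 7 <= mu) ->
  (forall k, `|(hpoly R ^+ n)`_k| * 2 ^+ k <= (q * 2 ^+ 7) ^+ n) ->
  rho ^+ 10 * mu <= al -> rho ^+ 10 * q <= be ->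
  1 <= H -> (u1 != 0) || (u2 != 0) -> `|u1%:~R| <= H -> `|u2%:~R| <= H ->
  1 <= C * rho ^+ 2 * (32 * H * al ^+ n + 4 * be ^+ n *
      `|u1%:~R * (ln 3 - ln 2) + u2%:~R * (ln 4 - ln 3)|).
Proof.
move=> C0 rho0 mu0 q0 lcmC hsup hcoef mual qbe H1 u0 u1H u2H.
pose La : R := u1%:~R * (ln 3 - ln 2) + u2%:~R * (ln 4 - ln 3); rewrite -/La.
have H0 : 0 <= H := le_trans ler01 H1.
have mn : (7 * n < 17 * n + 3)%N by lia.
have u0' : (u1%:~R != 0 :> R) || (u2%:~R != 0 :> R) by rewrite !intr_eq0.
have [j j3 lf0] := lform_neq0 mn u0'.
pose L : R := (lcm_upto (10 * n + 2))%:R.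
pose P := 'X^j * hpoly R ^+ n.
have Lint : L * lform (7 * n) u1%:~R u2%:~R P \is a Num.int.
  have i2 := @lcm_lprim_int R n j 2 j3 isT.
  have i3 := @lcm_lprim_int R n j 3 j3 isT.
  have i4 := @lcm_lprim_int R n j 4 j3 isT.
  have -> : L * lform (7 * n) u1%:~R u2%:~R P =
    u1%:~R * (L * lprim (7 * n) P 3 - L * lprim (7 * n) P 2) +
    u2%:~R * (L * lprim (7 * n) P 4 - L * lprim (7 * n) P 3).
    by rewrite /lform; ring.
  by rewrite rpredD// rpredM ?intr_int// rpredB.
have L0 : 0 < L by rewrite ltr0n lcm_upto_gt0.
have LC : L <= C * rho ^+ 2 * (rho ^+ 10) ^+ n.
  apply: (le_trans (lcmC _)); rewrite -(exprM rho 10) -mulrA -exprD.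
  by rewrite addnC.
have j4 : 4 ^+ j <= 16 :> R by case: j j3 {lf0 P Lint} => [|[|[|j]]]// _; lra.
have j2 : 2 ^+ j <= 4 :> R by case: j j3 {lf0 P Lint j4} => [|[|[|j]]]// _; lra.
have Pt (t : R) : 2 < t < 4 -> `|P.[t] / t ^+ (7 * n)| <= 16 * mu ^+ n.
  move=> t24; have /andP[t2 t4] := t24.
  have tp : 0 < t by apply: lt_trans t2.
  rewrite /P hornerM hornerXn horner_exp normrM normfV normrM !normrX (gtr0_norm tp).
  rewrite (exprM t 7) -mulrA -expr_div_n.
  apply: ler_pM.
  - by rewrite exprn_ge0 ?(ltW tp).
  - by rewrite exprn_ge0// divr_ge0// exprn_ge0 ?(ltW tp).
  - by apply: le_trans j4; rewrite lerXn2r ?nnegrE// ?(ltW tp) ?(ltW t4).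
  - by rewrite lerXn2r ?nnegrE ?hsup// divr_ge0// exprn_ge0 ?(ltW tp).
have Pm : `|P`_(7 * n)| <= 4 * q ^+ n.
  rewrite /P coefXnM; case: ltnP => nj.
    by rewrite normr0 mulr_ge0// exprn_ge0.
  have := hcoef (7 * n - j)%N; rewrite -ler_pdivlMr ?exprn_gt0//.
  move=> /le_trans; apply; rewrite ler_pdivrMr ?exprn_gt0//.
  rewrite exprMn -(exprM _ 7) -{1}(subnK nj) exprD.
  have -> : 4 * q ^+ n * 2 ^+ (7 * n - j) = q ^+ n * (2 ^+ (7 * n - j) * 4) by ring.
  by rewrite ler_wpM2l ?exprn_ge0// ler_wpM2l ?exprn_ge0.
have L1 : 0 < ln 3 - ln 2 :> R by rewrite subr_gt0 ltr_ln ?posrE ?ltr_nat.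
have L2 : 0 < ln 4 - ln 3 :> R by rewrite subr_gt0 ltr_ln ?posrE ?ltr_nat.
have ln_le (a b : R) : 0 < a -> a < b -> b <= 2 * a -> ln b - ln a <= 1.
  move=> a0 ab ba; have b0 := lt_trans a0 ab.
  rewrite -ln_div ?posrE// -(expRK 1) ler_ln ?posrE ?divr_gt0 ?expR_gt0//.
  apply: (@le_trans _ _ (1 + 1)); last exact: expR_ge1Dx.
  by rewrite ler_pdivrMr//; lra.
have L1' : ln 3 - ln 2 <= 1 :> R by apply: ln_le; lra.
have L2' : ln 4 - ln 3 <= 1 :> R by apply: ln_le; lra.
have [x xi Ex] := @lprim_MVT R (7 * n) P 2 3 (ltr0Sn _ _) ltac:(rewrite ltr_nat//).
have [y yi Ey] := @lprim_MVT R (7 * n) P 3 4 (ltr0Sn _ _) ltac:(rewrite ltr_nat//).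
have Px : `|P.[x] / x ^+ (7 * n)| <= 16 * mu ^+ n.
  apply: Pt; case/andP: xi => -> x3 /=; apply: lt_trans x3 _; by rewrite ltr_nat.
have Py : `|P.[y] / y ^+ (7 * n)| <= 16 * mu ^+ n.
  apply: Pt; case/andP: yi => y3 ->; rewrite andbT; apply: lt_trans y3; by rewrite ltr_nat.
have E : lform (7 * n) u1%:~R u2%:~R P =
  u1%:~R * ((ln 3 - ln 2) * (P.[x] / x ^+ (7 * n))) +
  u2%:~R * ((ln 4 - ln 3) * (P.[y] / y ^+ (7 * n))) - P`_(7 * n) * La.
  rewrite /lform /La -Ex -Ey; ring.
have T (u l p : R) : `|u| <= H -> 0 < l -> l <= 1 -> `|p| <= 16 * mu ^+ n ->
    `|u * (l * p)| <= 16 * H * mu ^+ n.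
  move=> uH l0 l1 pm; rewrite normrM.
  have -> : 16 * H * mu ^+ n = H * (16 * mu ^+ n) by ring.
  apply: ler_pM => //; rewrite normrM (gtr0_norm l0).
  by apply: le_trans pm; rewrite ler_piMl.
have lfle : `|lform (7 * n) u1%:~R u2%:~R P| <= 32 * H * mu ^+ n + 4 * q ^+ n * `|La|.
  rewrite E; apply: le_trans (ler_normB _ _) _; rewrite normrM.
  apply: lerD; last by rewrite ler_wpM2r.
  apply: le_trans (ler_normD _ _) _.
  have -> : 32 * H * mu ^+ n = 16 * H * mu ^+ n + 16 * H * mu ^+ n by ring.
  by apply: lerD; apply: T.
(* The decisive comparison: an integer that is nonzero by the choice of [j] has absolute value at
   least 1, while [lfle] bounds it from above. *)
have : 1 <= `|L * lform (7 * n) u1%:~R u2%:~R P|.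
  by apply: norm_intr_ge1 => //; rewrite mulf_neq0// gt_eqF.
move=> /le_trans; apply; rewrite normrM (gtr0_norm L0).
apply: le_trans (ler_pM (ltW L0) (normr_ge0 _) LC lfle) _.
rewrite -[leLHS]mulrA ler_wpM2l ?mulr_ge0 ?exprn_ge0 ?(ltW C0) ?(ltW rho0)//.
have -> : (rho ^+ 10) ^+ n * (32 * H * mu ^+ n + 4 * q ^+ n * `|La|) =
  32 * H * (rho ^+ 10 * mu) ^+ n + 4 * (rho ^+ 10 * q) ^+ n * `|La|.
  rewrite !exprMn; move: ((rho ^+ 10) ^+ n) (mu ^+ n) (q ^+ n) => *; ring.
have r10 : 0 <= rho ^+ 10 by rewrite exprn_ge0 ?(ltW rho0).
apply: lerD; first apply: ler_wpM2l.
- by rewrite mulr_ge0.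
- by rewrite lerXn2r// ?nnegrE ?(le_trans _ mual)// mulr_ge0.
rewrite ler_wpM2r// ler_wpM2l//.
by rewrite lerXn2r// ?nnegrE ?(le_trans _ qbe)// mulr_ge0.
Qed.

(** With [n] least such that the integrals contribute at most 1/2 in [log_form_key], al^n is of
    order 1 / H. Then [al ^ 16 * be <= 1] bounds be^n by a constant times H^16, and the linear form
    must supply the other 1/2. *)
Lemma log_form_lower_bound (R : realType) :
  exists2 c : R, 0 < c & forall (u1 u2 : int) (H : R), 1 <= H ->
    (u1 != 0) || (u2 != 0) -> `|u1%:~R| <= H -> `|u2%:~R| <= H ->
    c / H ^+ 16 <= `|u1%:~R * (ln 3 - ln 2) + u2%:~R * (ln 4 - ln 3)|.
Proof.
have [C C0 lcmC] := lcm_upto_le R.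
have [rho0 [al [be [al0 al1 be0 albe key]]]] : 0 < (303 / 100 : R) /\ exists al be : R,
   [/\ 0 < al, al < 1, 0 < be, al ^+ 16 * be <= 1 & forall n (u1 u2 : int) (H : R),
      1 <= H -> (u1 != 0) || (u2 != 0) -> `|u1%:~R| <= H -> `|u2%:~R| <= H ->
  1 <= C * (303 / 100) ^+ 2 * (32 * H * al ^+ n + 4 * be ^+ n *
      `|u1%:~R * (ln 3 - ln 2) + u2%:~R * (ln 4 - ln 3)|)].
  split; first by lra.
  (* Here 0.124 is an upper bound for 3.03^10 * 19 / 10^7, and 65240 one for 3.03^10; the last
     factor is 4^6 5^7 6^4 / 2^7. *)
  exists (124 / 1000), (6524 * 10 * (3240 * 10 ^+ 6)); split; [lra..|].
  have rho0 : 0 < 303 / 100 :> R by lra.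
  have mu0 : 0 <= 19 / 10 ^+ 7 :> R by rewrite divr_ge0// exprn_ge0.
  have q0 : 0 <= 3240 * 10 ^+ 6 :> R by rewrite mulr_ge0// exprn_ge0.
  have hal : (303 / 100) ^+ 10 * (19 / 10 ^+ 7) <= 124 / 1000 :> R by lra.
  have hbe : (303 / 100) ^+ 10 * (3240 * 10 ^+ 6) <= 6524 * 10 * (3240 * 10 ^+ 6) :> R by lra.
  have qE : 4 ^+ 6 * 5 ^+ 7 * 6 ^+ 4 = 3240 * 10 ^+ 6 * 2 ^+ 7 :> R by lra.
  move=> n u1 u2 H.
  have hc k := hpolyX_coef_le R n k; rewrite qE in hc.
  exact: log_form_key C0 rho0 mu0 q0 lcmC (@hpoly_sup R) hc hal hbe.
pose C1 : R := C * (303 / 100) ^+ 2.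
have C10 : 0 < C1 by rewrite mulr_gt0// exprn_gt0.
move: key; rewrite -/C1; move: C1 C10 => {C0 lcmC rho0} C1 C10 key.
(* More than 64 C1, so that al^n K H <= 1 makes the term with 32 H al^n at most 1/2; more than 1, so
   that n = 0 is not yet admissible. *)
pose K := 64 * C1 + 1.
have K0 : 0 < K by rewrite /K; lra.
exists (al ^+ 16 / (8 * C1 * K ^+ 16)).
  by rewrite divr_gt0 ?mulr_gt0 ?exprn_gt0//; lra.
move=> u1 u2 H H1 u0 u1H u2H.
set La := `|_|.
have H0 : 0 < H by lra.
have [n an an'] : exists2 n, al ^+ n * (K * H) <= 1 & al <= al ^+ n * (K * H).
  pose P n := al ^+ n * (K * H) <= 1.
  have exP : exists n, P n.
    have [D D0 HD] := @natX_geom_bounded R al 1 (ltW al0) al1.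
    pose n := (Num.truncn (D * (K * H))).+1.
    have nD : D * (K * H) < n%:R by exact: truncnS_gt.
    exists n; have n0 : 0 < n%:R :> R by [].
    have KH0 : 0 <= K * H by rewrite mulr_ge0 ?ltW.
    rewrite /P -(ler_pM2l n0) mulr1; apply: le_trans (ltW nD).
    by have := ler_wpM2r KH0 (HD n); rewrite expr1 -mulrA.
  have := ex_minnP exP; case=> [[|n] Pn nmin].
    have K1 : 1 < K by rewrite /K; lra.
    by move: Pn; rewrite /P expr0 mul1r leNgt (lt_le_trans K1)// ler_peMr ?(ltW K0).
  exists n.+1 => //; rewrite exprS -mulrA ler_peMr ?(ltW al0)//.
  by rewrite leNgt; apply/negP => /ltW /nmin; rewrite ltnn.
have := key n u1 u2 H H1 u0 u1H u2H; rewrite -/La => key1.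
have k2 : C1 * (32 * H * al ^+ n) <= 1 / 2.
  move: an; rewrite /K; have : 0 <= al ^+ n by rewrite exprn_ge0// ltW.
  move: (al ^+ n) => a a0; nra.
have k3 : 1 / 2 <= 4 * C1 * be ^+ n * La by move: key1; rewrite mulrDr; lra.
have ben0 : 0 < be ^+ n by rewrite exprn_gt0.
have be_le : al ^+ 16 * be ^+ n <= (K * H) ^+ 16.
  have s1 : (al ^+ n) ^+ 16 * be ^+ n <= 1.
    rewrite -exprM mulnC exprM -exprMn; apply: exprn_ile1 => //.
    by rewrite mulr_ge0 ?exprn_ge0 ?ltW.
  have KH0 : 0 <= K * H by rewrite mulr_ge0 ?ltW.
  apply: (@le_trans _ _ ((al ^+ n * (K * H)) ^+ 16 * be ^+ n)).
    by rewrite ler_wpM2r ?(ltW ben0)// lerXn2r ?nnegrE ?mulr_ge0 ?exprn_ge0 ?(ltW al0) ?(ltW K0) ?(ltW H0).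
  rewrite (exprMn 16 (al ^+ n) (K * H)) mulrAC ler_piMl// exprn_ge0//.
have La0 : 0 <= La by exact: normr_ge0.
rewrite -mulrA -invfM ler_pdivrMr; last by rewrite !mulr_gt0 ?exprn_gt0//; lra.
have -> : 8 * C1 * K ^+ 16 * H ^+ 16 = 8 * C1 * (K * H) ^+ 16.
  by rewrite (exprMn 16 K H) [RHS]mulrA.
apply: (@le_trans _ _ (8 * C1 * (al ^+ 16 * be ^+ n) * La)); last first.
  rewrite [leRHS]mulrC ler_wpM2r// ler_wpM2l//; lra.
have a16 : 0 <= al ^+ 16 by rewrite exprn_ge0 ?ltW.
have : 0 <= al ^+ 16 * (4 * C1 * be ^+ n * La - 1 / 2) by rewrite mulr_ge0// subr_ge0.
move: (al ^+ 16) (be ^+ n) => A B; nra.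
Qed.

(** * Trigonometric inequalities and the kernels of Dirichlet and Fejer *)

Section Trig.
Variable R : realType.
Implicit Types x y z a : R.

Lemma cosD2pin x k : cos (x + 2 * pi * k%:R) = cos x.
Proof.
by rewrite mulr_natr mulr_natl (periodicn (@cosD2pi R)).
Qed.

Lemma sinD2pin x k : sin (x + 2 * pi * k%:R) = sin x.
Proof.
by rewrite mulr_natr mulr_natl (periodicn (@sinD2pi R)).
Qed.

(** By the mean value theorem sin(y/2) >= (y/2) cos(y/2), hence sin y = 2 sin(y/2) cos(y/2) >= y
    cos(y/2)^2 = y (1 + cos y) / 2. *)
Lemma sin_ge_half y : 0 <= y -> y <= pi / 2 -> y / 2 <= sin y.
Proof.
move=> y0 ypi; have pi0 := pi_gt0 R.
have [->|yn0] := eqVneq y 0; first by rewrite mul0r sin0.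
have yp : 0 < y / 2 by rewrite divr_gt0// lt_def yn0.
have [c /andP[c0 cy]] := @is_derive_MVT R sin cos 0 (y / 2) yp (@is_derive_sin R).
rewrite sin0 subr0 => E.
have h2 : cos (y / 2) <= cos c.
  have : cos (y / 2) < cos c.
    by rewrite ltr_cos// in_itv/=; apply/andP; split; lra.
  exact: ltW.
have h3 : 0 <= cos (y / 2) by apply: cos_ge0_pihalf; apply/andP; split; lra.
have h4 : 0 <= cos y by apply: cos_ge0_pihalf; apply/andP; split; lra.
have yE : y = y / 2 + y / 2 by lra.
have s2 : sin y = 2 * (sin (y / 2) * cos (y / 2)) by rewrite {1}yE sinD; lra.
have c2 : 1 + cos y = 2 * cos (y / 2) ^+ 2.
  by rewrite [in LHS]yE cosD; have := cos2Dsin2 (y / 2); rewrite !expr2; lra.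
rewrite s2 E subr0.
have : cos (y / 2) ^+ 2 <= cos c * cos (y / 2) by rewrite expr2 ler_wpM2r.
have := mulr_ge0 (ltW yp) (mulr_ge0 (ler0n R 1) h4).
nra.
Qed.

Lemma sinpi_ge z : 0 <= z -> z <= 1 / 2 -> z <= sin (pi * z).
Proof.
move=> z0 z2; have pi2 := pi_ge2 R.
apply: (@le_trans _ _ (pi * z / 2)); first by nra.
by apply: sin_ge_half; nra.
Qed.

Lemma sum_cos_telescope y a p q : (p <= q)%N ->
  2 * sin (y / 2) * \sum_(p <= t < q) cos (t%:R * y - a) =
  sin ((q%:R - 1 / 2) * y - a) - sin ((p%:R - 1 / 2) * y - a).
Proof.
move=> pq; rewrite mulr_sumr -[RHS](@telescope_sumr _ p q
  (fun t => sin ((t%:R - 1 / 2) * y - a)))//; apply: eq_bigr => t _.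
rewrite -[t.+1%:R]natr1.
have -> : (t%:R + 1 - 1 / 2) * y - a = (t%:R * y - a) + y / 2 by lra.
have -> : (t%:R - 1 / 2) * y - a = (t%:R * y - a) - y / 2 by lra.
by move: (t%:R * y - a) => w; rewrite sinD sinB; ring.
Qed.

Definition dirichlet k x : R := 1 + 2 * \sum_(j < k) cos (j.+1%:R * x).
Definition fejer J x : R := \sum_(k < J) dirichlet k x.

Lemma dirichletE k x : sin (x / 2) * dirichlet k x = sin ((k%:R + 1 / 2) * x).
Proof.
elim: k => [|k IH].
  by rewrite /dirichlet big_ord0 mulr0 addr0 mulr1; congr sin; lra.
have -> : dirichlet k.+1 x = dirichlet k x + 2 * cos (k.+1%:R * x).
  by rewrite /dirichlet big_ord_recr/=; ring.
rewrite mulrDr IH -[k.+1%:R]natr1.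
have -> : (k%:R + 1 / 2) * x = (k%:R + 1) * x - x / 2 by lra.
have -> : (k%:R + 1 + 1 / 2) * x = (k%:R + 1) * x + x / 2 by lra.
by move: ((k%:R + 1) * x) => w; rewrite sinB sinD; ring.
Qed.

(** The induction step is sin((J+1)x/2)^2 - sin(Jx/2)^2 = sin(x/2) sin((J+1/2)x), combined with
    [dirichletE]. *)
Lemma fejerE J x : sin (x / 2) ^+ 2 * fejer J x = sin (J%:R * x / 2) ^+ 2.
Proof.
elim: J => [|J IH]; first by rewrite /fejer big_ord0 mul0r mul0r sin0 expr0n mulr0.
have -> : fejer J.+1 x = fejer J x + dirichlet J x by rewrite /fejer big_ord_recr.
have E : sin (x / 2) ^+ 2 * dirichlet J x = sin (x / 2) * sin ((J%:R + 1 / 2) * x).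
  by rewrite expr2 -mulrA dirichletE.
rewrite mulrDr IH E -[J.+1%:R]natr1.
have -> : (J%:R + 1) * x / 2 = J%:R * x / 2 + x / 2 by lra.
have -> : (J%:R + 1 / 2) * x = J%:R * x / 2 + (J%:R * x / 2 + x / 2) by lra.
set u := J%:R * x / 2; set v := x / 2.
have := cos2Dsin2 u; have := cos2Dsin2 v; rewrite (sinD u (u + v)) sinD cosD !expr2.
move: (sin u) (cos u) (sin v) (cos v) => su cu sv cv h1 h2.
have e1 : cv * cv = 1 - sv * sv by lra.
have e2 : cu * cu = 1 - su * su by lra.
have -> : (su * cv + cu * sv) * (su * cv + cu * sv) =
  su * su * (cv * cv) + 2 * su * cu * sv * cv + cu * cu * (sv * sv) by ring.
have -> : sv * (su * (cu * cv - su * sv) + cu * (su * cv + cu * sv)) =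
  2 * su * cu * sv * cv - su * su * (sv * sv) + cu * cu * (sv * sv) by ring.
rewrite e1 e2; ring.
Qed.

Lemma fejer_ge0 J x : 0 < sin (x / 2) \/ x = 0 -> 0 <= fejer J x.
Proof.
case=> [s0|->].
  have s2 : 0 < sin (x / 2) ^+ 2 by rewrite exprn_gt0.
  by rewrite -(pmulr_rge0 _ s2) fejerE sqr_ge0.
rewrite /fejer sumr_ge0// => k _; rewrite /dirichlet addr_ge0// mulr_ge0// sumr_ge0// => j _.
by rewrite mulr0 cos0.
Qed.

Lemma sum_inv_sqr_le (a b : nat) : (0 < a)%N ->
  \sum_(a.+1 <= s < b) (s%:R ^+ 2)^-1 <= a%:R^-1 :> R.
Proof.
move=> a0; have [ba|ab] := leqP b a.+1.
  by rewrite big_geq// invr_ge0.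
apply: (@le_trans _ _ (\sum_(a.+1 <= s < b) (s.-1%:R^-1 - s%:R^-1))).
  rewrite big_nat_cond [leRHS]big_nat_cond; apply: ler_sum => s /andP[/andP[sa _] _].
  case: s sa => // s sa /=.
  have s0 : 0 < s%:R :> R by rewrite ltr0n; lia.
  have s1 : 0 < s.+1%:R :> R by rewrite ltr0n.
  rewrite -subr_ge0.
  have -> : s%:R^-1 - s.+1%:R^-1 - (s.+1%:R ^+ 2)^-1 = (s%:R * s.+1%:R ^+ 2)^-1 :> R.
    by rewrite -[s.+1%:R]natr1 in s1 *; field; rewrite !gt_eqF.
  by rewrite invr_ge0 mulr_ge0 ?exprn_ge0.
have := @telescope_sumr R a.+1 b (fun s => - s.-1%:R^-1) (ltnW ab).
under eq_bigr do rewrite opprK addrC /=.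
move=> ->; rewrite opprK /= gerDr oppr_le0 invr_ge0//.
Qed.

End Trig.

(** * The Fejer kernel as a probability weight on the residues modulo M *)

Section Kernel.
Variables (R : realType) (M J : nat).
Hypotheses (J0 : (0 < J)%N) (JM : (2 * J <= M)%N).

Let M0 : (0 < M)%N. Proof. by apply: leq_trans JM; rewrite muln_gt0. Qed.
Let MR : 0 < M%:R :> R. Proof. by rewrite ltr0n. Qed.
Let JR : 0 < J%:R :> R. Proof. by rewrite ltr0n. Qed.

Definition mesh_angle : R := 2 * pi / M%:R.
Definition fker (s : nat) : R := fejer J (s%:R * mesh_angle) / (J%:R * M%:R).

Lemma ang_half (z : R) : z * mesh_angle / 2 = pi * (z / M%:R).
Proof. by rewrite /mesh_angle; field; rewrite gt_eqF. Qed.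

Lemma sin_ang_gt0 s : (0 < s < M)%N -> 0 < sin (s%:R * mesh_angle / 2).
Proof.
move=> /andP[s0 sM]; rewrite ang_half; apply: sin_gt0_pi.
have pi0 := pi_gt0 R; apply/andP; split; first by rewrite mulr_gt0// divr_gt0 ?ltr0n.
by rewrite gtr_pMr// ltr_pdivrMr// mul1r ltr_nat.
Qed.

Lemma fker_ge0 s : (s < M)%N -> 0 <= fker s.
Proof.
move=> sM; rewrite divr_ge0 ?mulr_ge0//; apply: fejer_ge0.
case: s sM => [|s] sM; first by right; rewrite mul0r.
by left; apply: sin_ang_gt0.
Qed.

Lemma sum_cos_ang j : (0 < j < M)%N -> \sum_(s < M) cos (j%:R * (s%:R * mesh_angle)) = 0.
Proof.
move=> jM; have := @sum_cos_telescope R (j%:R * mesh_angle) 0 0 M (leq0n _).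
have -> : (M%:R - 1 / 2) * (j%:R * mesh_angle) - 0 = - (j%:R * mesh_angle / 2) + 2 * pi * j%:R.
  by rewrite /mesh_angle; field; rewrite gt_eqF.
rewrite sinD2pin sinN.
have -> : (0%:R - 1 / 2) * (j%:R * mesh_angle) - 0 = - (j%:R * mesh_angle / 2) by lra.
rewrite sinN subrr => /eqP; rewrite mulf_eq0 mulf_eq0 pnatr_eq0/=.
rewrite gt_eqF ?sin_ang_gt0//= => /eqP H.
rewrite -[RHS]H big_mkord; apply: eq_bigr => s _; congr cos; ring.
Qed.

Lemma sum_fker : \sum_(s < M) fker s = 1.
Proof.
rewrite -mulr_suml; apply/eqP; rewrite eq_sym -subr_eq0; apply/eqP.
suff -> : \sum_(i < M) fejer J (i%:R * mesh_angle) = J%:R * M%:R.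
  by rewrite divff ?subrr// mulf_neq0 ?gt_eqF.
rewrite exchange_big/=.
rewrite (eq_bigr (fun=> M%:R)); last first.
  move=> k _; rewrite /dirichlet big_split/= sumr_const card_ord -mulr_sumr exchange_big/=.
  rewrite big1 ?mulr0 ?addr0// => j _; apply: sum_cos_ang.
  have := ltn_ord k; have := ltn_ord j; lia.
by rewrite sumr_const card_ord mulr_natl.
Qed.

(** The Fejer sum is at most 1 / sin(pi s / M)^2, and this sine is at least the distance from s to
    the nearer of 0 and M, divided by M. Adding the terms of both ends avoids naming the nearer
    one. *)
Lemma fker_le s : (0 < s < M)%N ->
  fker s <= M%:R / J%:R * ((s%:R ^+ 2)^-1 + ((M - s)%N%:R ^+ 2)^-1).
Proof.
move=> /andP[s0 sM].
have sp := @sin_ang_gt0 s; rewrite s0 sM in sp; have {}sp := sp isT.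
have f1 : sin (s%:R * mesh_angle / 2) ^+ 2 * fejer J (s%:R * mesh_angle) <= 1.
  rewrite fejerE; move: (_ / 2) => z.
  by have := cos2Dsin2 z; have := sqr_ge0 (cos z); lra.
have sR : 0 < s%:R :> R by rewrite ltr0n.
have tR : 0 < (M - s)%N%:R :> R by rewrite ltr0n subn_gt0.
have lb (r : nat) : (0 < r)%N -> r%:R / M%:R <= sin (s%:R * mesh_angle / 2) ->
    fker s <= M%:R / J%:R * (r%:R ^+ 2)^-1.
  move=> r0 h; have rR : 0 < r%:R :> R by rewrite ltr0n.
  rewrite /fker ler_pdivrMr ?mulr_gt0//.
  have -> : M%:R / J%:R * (r%:R ^+ 2)^-1 * (J%:R * M%:R) = ((r%:R / M%:R) ^+ 2)^-1 :> R.
    by field; rewrite !gt_eqF.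
  have rM : 0 < r%:R / M%:R :> R by rewrite divr_gt0.
  rewrite -[leRHS]mul1r ler_pdivlMr ?exprn_gt0//; apply: le_trans f1.
  rewrite mulrC ler_wpM2r//.
    by apply: fejer_ge0; left.
  by rewrite lerXn2r ?nnegrE ?(ltW rM) ?(ltW sp).
have c0 : 0 <= M%:R / J%:R :> R by rewrite divr_ge0.
have [s2|s2] := leqP (2 * s) M.
  apply: (le_trans (lb s s0 _)).
    rewrite ang_half; apply: sinpi_ge; first by rewrite divr_ge0.
    rewrite ler_pdivrMr// mulrAC mul1r ler_pdivlMr//.
    by rewrite -natrM ler_nat mulnC.
  by rewrite ler_wpM2l// lerDl invr_ge0 exprn_ge0.
apply: (le_trans (lb (M - s)%N _ _)).
- by rewrite subn_gt0.
- have -> : sin (s%:R * mesh_angle / 2) = sin (pi * ((M - s)%N%:R / M%:R)).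
    rewrite ang_half natrB ?(ltnW sM)//.
    have -> : pi * ((M%:R - s%:R) / M%:R) = - (pi * (s%:R / M%:R)) + pi :> R.
      by field; rewrite gt_eqF.
    by rewrite sinDpi sinN opprK.
  apply: sinpi_ge; first by rewrite divr_ge0.
  rewrite ler_pdivrMr// mulrAC mul1r ler_pdivlMr//.
  by rewrite -natrM ler_nat; lia.
by rewrite ler_wpM2l// lerDr invr_ge0 exprn_ge0.
Qed.

Lemma fker_tail d : (0 < d)%N ->
  \sum_(d.+1 <= s < M - d) fker s <= 2 * M%:R / (J%:R * d%:R).
Proof.
move=> d0; have dR : 0 < d%:R :> R by rewrite ltr0n.
apply: (@le_trans _ _ (\sum_(d.+1 <= s < M - d)
    M%:R / J%:R * ((s%:R ^+ 2)^-1 + ((M - s)%N%:R ^+ 2)^-1))).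
  rewrite big_nat_cond [leRHS]big_nat_cond; apply: ler_sum => s /andP[/andP[sa sb] _].
  by apply: fker_le; lia.
rewrite -mulr_sumr big_split/=.
have h1 := sum_inv_sqr_le R (M - d) d0.
have h2 : \sum_(d.+1 <= s < M - d) ((M - s)%N%:R ^+ 2)^-1 <= d%:R^-1 :> R.
  apply: le_trans h1; rewrite big_nat_rev/= big_nat_cond [leRHS]big_nat_cond.
  rewrite le_eqVlt; apply/orP; left; apply/eqP; apply: eq_bigr => s /andP[/andP[sa sb] _].
  by congr ((_%:R ^+ 2)^-1); lia.
have -> : 2 * M%:R / (J%:R * d%:R) = M%:R / J%:R * (d%:R^-1 + d%:R^-1) :> R.
  by field; rewrite !gt_eqF.
by rewrite ler_wpM2l ?divr_ge0// lerD.
Qed.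

End Kernel.

(** * Erdos-Turan inequality for points of Z/M *)

Section ErdosTuran.
Variables (R : realType) (M J L : nat) (ns : seq nat).
Hypotheses (J0 : (1 < J)%N) (L0 : (0 < L)%N) (ML : M = (J * L)%N) (JM : (2 * J <= M)%N)
  (nsM : all (fun n => n < M)%N ns).

Let M0 : (0 < M)%N. Proof. by move: J0 JM; lia. Qed.
Let MR : 0 < M%:R :> R. Proof. by rewrite ltr0n. Qed.
Let JR : 0 < J%:R :> R. Proof. by rewrite ltr0n; move: J0; lia. Qed.
Let N : R := (size ns)%:R.
Local Notation ang := (mesh_angle R M).
Local Notation K := (fker R M J).

Definition hits (u : nat) : R := (count (fun n => n == u %% M)%N ns)%:R.
Definition excess (t : nat) : R := \sum_(u < t) hits u - N * t%:R / M%:R.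

Definition expsum (j : nat) : R :=
  Num.sqrt ((\sum_(n <- ns) cos (j%:R * (n%:R * ang))) ^+ 2 +
            (\sum_(n <- ns) sin (j%:R * (n%:R * ang))) ^+ 2).

(** The counting part never decreases, so the excess falls at rate at most N / M. This one-sided
    continuity spreads an extreme value over a neighbourhood. *)
Lemma excessD t e : excess t - N * e%:R / M%:R <= excess (t + e).
Proof.
rewrite /excess -!(big_mkord xpredT hits) (@big_cat_nat _ _ _ t 0 (t + e))//= ?leq_addr//.
rewrite natrD mulrDr mulrDl.
have : 0 <= \sum_(t <= u < t + e) hits u by rewrite sumr_ge0.
lra.
Qed.

Lemma hitsE u : hits u = \sum_(n <- ns) (n == u %% M)%N%:R.
Proof.
rewrite /hits -sum1_count natr_sum big_mkcond/=; apply: eq_bigr => n _.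
by case: eqP.
Qed.

Lemma sum_hits_M : \sum_(u < M) hits u = N.
Proof.
rewrite /N -sum1_size natr_sum (eq_bigr _ (fun (u : 'I_M) _ => hitsE u)) exchange_big/=.
rewrite big_seq [RHS]big_seq; apply: eq_bigr => n nn.
have nM := allP nsM _ nn.
rewrite (bigD1 (Ordinal nM))//= modn_small// eqxx big1 ?addr0// => u un.
by rewrite modn_small// eq_sym -[n]/(val (Ordinal nM)) val_eqE (negbTE un).
Qed.

Lemma hitsDM u : hits (u + M) = hits u.
Proof. by rewrite /hits modnDr. Qed.

Lemma excessDM t : excess (t + M) = excess t.
Proof.
rewrite /excess -!(big_mkord xpredT hits).
have H : \sum_(0 <= u < t + M) hits u = \sum_(0 <= u < t) hits u + N.
  rewrite addnC (@big_cat_nat _ _ _ M 0 (M + t))//= ?leq_addr//.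
  rewrite (big_mkord _ hits) sum_hits_M addrC; congr (_ + _).
  rewrite -{1}[M]add0n (addnC M t) big_addn addnK.
  by apply: eq_bigr => u _; rewrite hitsDM.
rewrite H natrD mulrDr mulrDl mulfK ?gt_eqF//; ring.
Qed.

Lemma excessDMn t k : excess (t + k * M) = excess t.
Proof.
by elim: k => [|k IH]; rewrite ?mul0n ?addn0// mulSn addnCA addnC excessDM.
Qed.

Lemma excess_mod t : excess (t %% M) = excess t.
Proof. by rewrite {2}(divn_eq t M) addnC excessDMn. Qed.

Lemma sum_ker_hits (j t : nat) :
  \sum_(s < M) cos (j%:R * (s%:R * ang)) * hits (t + s) =
  \sum_(n <- ns) cos (t%:R * (j%:R * ang) - j%:R * (n%:R * ang)).
Proof.
have H (s : 'I_M) : true -> cos (j%:R * (s%:R * ang)) * hits (t + s) =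
    \sum_(n <- ns) cos (j%:R * (s%:R * ang)) * (n == (t + s) %% M)%N%:R.
  by move=> _; rewrite hitsE mulr_sumr.
rewrite (eq_bigr _ H) exchange_big/= big_seq [RHS]big_seq; apply: eq_bigr => n nn.
have nM := allP nsM _ nn.
(* The residue of n - t, the only shift at which the point [n] is hit. *)
pose s0 := ((n + (M - t %% M)) %% M)%N.
have s0M : (s0 < M)%N by rewrite ltn_pmod.
have key (s : nat) : (s < M)%N -> (n == (t + s) %% M)%N = (s == s0).
  move=> sM; have tM := ltn_pmod t M0.
  have -> : (n == (t + s) %% M)%N = (n %% M == (t %% M + s) %% M)%N.
    by rewrite modnDml (modn_small nM).
  have -> : (s == s0) = (s %% M == s0)%N by rewrite modn_small.
  apply/eqP/eqP => [E|E].
    by rewrite /s0 -modnDml E modnDml addnAC subnKC ?(ltnW tM)// modnDl.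
  by rewrite -(modnDmr _ s) E /s0 modnDmr addnCA subnKC ?(ltnW tM)// modnDr.
rewrite (bigD1 (Ordinal s0M))//= key// eqxx mulr1 big1 ?addr0; last first.
  move=> s; rewrite -val_eqE/= => /negbTE ss0.
  by rewrite key// ss0 mulr0.
have E0 : (n == (t + s0) %% M)%N by rewrite key.
have tE := divn_eq (t + s0) M; rewrite -(eqP E0) in tE.
have -> : j%:R * (s0%:R * ang) = - (t%:R * (j%:R * ang) - j%:R * (n%:R * ang)) +
   2 * pi * (j * ((t + s0) %/ M))%N%:R.
  have : (t + s0)%N%:R = ((t + s0) %/ M)%N%:R * M%:R + n%:R :> R.
    by rewrite {1}tE natrD natrM.
  rewrite natrD natrM => h.
  have -> : s0%:R = ((t + s0) %/ M)%N%:R * M%:R + n%:R - t%:R :> R by lra.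
  by rewrite /mesh_angle; field; rewrite gt_eqF.
by rewrite cosD2pin cosN.
Qed.

(** The sum over t telescopes to two end terms, each at most [expsum j] by Cauchy-Schwarz, divided
    by 2 sin(pi j / M) >= 2 j / M. The bound does not depend on the length q - p. *)
Lemma sum_sum_cos_le j p q : (0 < j)%N -> (2 * j <= M)%N -> (p <= q)%N ->
  `|\sum_(p <= t < q) \sum_(n <- ns) cos (t%:R * (j%:R * ang) - j%:R * (n%:R * ang))|
    <= expsum j * M%:R / j%:R.
Proof.
move=> j0 jM pq; have jR : 0 < j%:R :> R by rewrite ltr0n.
set y := j%:R * ang.
have sy : j%:R / M%:R <= sin (y / 2).
  rewrite /y (@ang_half R M J (ltnW J0) JM); apply: sinpi_ge; first by rewrite divr_ge0.
  by rewrite ler_pdivrMr// mulrAC mul1r ler_pdivlMr// -natrM ler_nat mulnC.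
have jM0 : 0 < j%:R / M%:R :> R by rewrite divr_gt0.
have sy0 : 0 < sin (y / 2) := lt_le_trans jM0 sy.
have lin (a : R) : `|\sum_(n <- ns) sin (a - j%:R * (n%:R * ang))| <= expsum j.
  have -> : \sum_(n <- ns) sin (a - j%:R * (n%:R * ang)) =
    sin a * (\sum_(n <- ns) cos (j%:R * (n%:R * ang))) -
    cos a * (\sum_(n <- ns) sin (j%:R * (n%:R * ang))).
    by rewrite !mulr_sumr -sumrB; apply: eq_bigr => n _; rewrite sinB.
  rewrite /expsum; move: (\sum_(n <- ns) cos (j%:R * (n%:R * ang)))
    (\sum_(n <- ns) sin (j%:R * (n%:R * ang))) => C S.
  rewrite -sqrtr_sqr ler_wsqrtr//.
  have := cos2Dsin2 a; have := sqr_ge0 (cos a * C + sin a * S).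
  rewrite !expr2; move: (cos a) (sin a) => ca sa h1 h2.
  have -> : (sa * C - ca * S) * (sa * C - ca * S) =
    (ca * ca + sa * sa) * (C * C + S * S) - (ca * C + sa * S) * (ca * C + sa * S) by ring.
  rewrite h2; lra.
set T := \sum_(p <= t < q) _.
have TE : 2 * sin (y / 2) * T =
   \sum_(n <- ns) sin ((q%:R - 1 / 2) * y - j%:R * (n%:R * ang)) -
   \sum_(n <- ns) sin ((p%:R - 1 / 2) * y - j%:R * (n%:R * ang)).
  rewrite /T exchange_big/= mulr_sumr -sumrB; apply: eq_bigr => n _.
  exact: sum_cos_telescope.
have : `|2 * sin (y / 2) * T| <= expsum j + expsum j.
  by rewrite TE; apply: le_trans (ler_normB _ _) (lerD (lin _) (lin _)).
rewrite normrM gtr0_norm ?mulr_gt0// => h.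
rewrite ler_pdivlMr// -ler_pdivrMr// -mulrA.
apply: (@le_trans _ _ (`|T| * sin (y / 2))); first by rewrite ler_wpM2l.
lra.
Qed.

(** Frequency 0 of the kernel reproduces the expected count N (q - p) / M exactly; the other
    frequencies are bounded by [sum_sum_cos_le]. *)
Lemma smoothed_excess_le p q : (p <= q)%N ->
  \sum_(s < M) K s * (excess (q + s) - excess (p + s)) <=
  2 * \sum_(j < J) expsum j.+1 / j.+1%:R.
Proof.
move=> pq.
have ex s : excess (q + s) - excess (p + s) =
    \sum_(p <= t < q) hits (t + s) - N * (q%:R - p%:R) / M%:R.
  rewrite /excess -!(big_mkord xpredT hits).
  rewrite (@big_cat_nat _ _ _ (p + s) 0 (q + s))//= ?leq_add2r//.
  have -> : \sum_(p + s <= i < q + s) hits i = \sum_(p <= t < q) hits (t + s).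
    by rewrite big_addn addnK.
  rewrite !natrD; lra.
under eq_bigr do rewrite ex mulrBr.
rewrite sumrB -mulr_suml sum_fker//; last by rewrite ltnW.
under eq_bigr do rewrite mulr_sumr.
rewrite exchange_big/= mul1r.
pose c (j t : nat) : R := \sum_(n <- ns) cos (t%:R * (j%:R * ang) - j%:R * (n%:R * ang)).
have inner t : \sum_(s < M) K s * hits (t + s) =
    (\sum_(k < J) (N + 2 * \sum_(j < k) c j.+1 t)) / (J%:R * M%:R).
  rewrite /fker /fejer /dirichlet.
  under eq_bigr do rewrite mulrAC.
  rewrite -mulr_suml; congr (_ / _).
  under eq_bigr do rewrite mulr_suml.
  rewrite exchange_big/=; apply: eq_bigr => k _.
  under eq_bigr do rewrite mulrDl mul1r -mulrA mulr_suml.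
  rewrite big_split/= -mulr_sumr; congr (_ + 2 * _).
    transitivity (\sum_(s < M) cos (0%:R * (s%:R * ang)) * hits (t + s)).
      by apply: eq_bigr => s _; rewrite mul0r cos0 mul1r.
    rewrite sum_ker_hits (eq_bigr (fun=> 1)).
      by rewrite /N -sum1_size natr_sum.
    by move=> n _; rewrite !mul0r mulr0 subrr cos0.
  by rewrite exchange_big/=; apply: eq_bigr => j _; rewrite sum_ker_hits.
under eq_bigr do rewrite inner.
have -> : \sum_(p <= t < q) (\sum_(k < J) (N + 2 * \sum_(j < k) c j.+1 t)) / (J%:R * M%:R)
  - N * (q%:R - p%:R) / M%:R =
  2 / (J%:R * M%:R) * \sum_(k < J) \sum_(j < k) \sum_(p <= t < q) c j.+1 t.
  rewrite -mulr_suml.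
  have -> : \sum_(p <= t < q) \sum_(k < J) (N + 2 * \sum_(j < k) c j.+1 t) =
    J%:R * (N * (q%:R - p%:R)) +
    2 * \sum_(k < J) \sum_(j < k) \sum_(p <= t < q) c j.+1 t.
    rewrite exchange_big/=.
    under eq_bigr do rewrite big_split/= -mulr_sumr exchange_big/=.
    rewrite big_split/= -mulr_sumr; congr (_ + _).
    rewrite sumr_const_nat sumr_const card_ord -natrB//.
    by rewrite -mulrnA -[LHS]mulr_natr natrM; ring.
  by field; rewrite !gt_eqF.
have -> : 2 * \sum_(j < J) expsum j.+1 / j.+1%:R =
    2 / (J%:R * M%:R) * (\sum_(k < J) M%:R * \sum_(j < J) expsum j.+1 / j.+1%:R).
  by rewrite sumr_const card_ord -[_ *+ J]mulr_natl; field; rewrite !gt_eqF.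
rewrite ler_wpM2l ?divr_ge0 ?mulr_ge0//; apply: ler_sum => k _.
have e0 j : 0 <= expsum j.+1 / j.+1%:R :> R by rewrite divr_ge0// sqrtr_ge0.
apply: (@le_trans _ _ (M%:R * \sum_(j < k) expsum j.+1 / j.+1%:R)); last first.
  rewrite ler_wpM2l// (big_ord_widen J (fun j => expsum j.+1 / j.+1%:R) (ltnW (ltn_ord k))).
  by rewrite big_mkcond/=; apply: ler_sum => j _; case: ifP.
rewrite mulr_sumr; apply: ler_sum => j _.
apply: le_trans (ler_norm _) _.
have -> : M%:R * (expsum j.+1 / j.+1%:R) = expsum j.+1 * M%:R / j.+1%:R by ring.
apply: sum_sum_cos_le => //; have := ltn_ord k; have := ltn_ord j; lia.
Qed.

(** Let the excess be maximal at q and minimal at p, with difference D. Centre the kernel at q + d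
    and at p - d: within d of the centres the difference is still at least D - 2 N d / M by
    [excessD], and elsewhere it is at least -D. A tail of mass at most 1/8 leaves 3/4 D. *)
Lemma erdos_turan_discrete s t :
  3 / 4 * (excess s - excess t) <=
  2 * \sum_(j < J) expsum j.+1 / j.+1%:R + 32 * N / J%:R.
Proof.
(* As M = J L, this makes the tail bound 2 M / (J d) equal to 1/8 and the loss 2 N d / M equal to 32
   N / J. *)
pose d := (16 * L)%N.
have d0 : (0 < d)%N by rewrite /d; lia.
have [q qmax] : exists q, forall u, excess u <= excess q.
  pose i := [arg max_(i > Ordinal M0) excess (i : 'I_M)]%O.
  exists i => u; rewrite /i; case: arg_maxP => // k _ kmax.
  by rewrite -(excess_mod u); apply: (kmax (Ordinal (ltn_pmod u M0))).
have [p pmin] : exists p, forall u, excess p <= excess u.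
  pose i := [arg min_(i < Ordinal M0) excess (i : 'I_M)]%O.
  exists i => u; rewrite /i; case: arg_minP => // k _ kmin.
  by rewrite -(excess_mod u); apply: (kmin (Ordinal (ltn_pmod u M0))).
pose D := excess q - excess p.
have D0 : 0 <= D by rewrite subr_ge0.
apply: (@le_trans _ _ (3 / 4 * D)).
  by apply: ler_wpM2l; [lra|exact: lerB].
(* These are p - d and q + d modulo M; the added periods keep [p'] a natural number and ensure p' <=
   q'. *)
pose p' := (p + d * M - d)%N; pose q' := (q + d + (p + d.+1) * M)%N.
have dM : (d <= d * M)%N by rewrite leq_pmulr.
have pq : (p' <= q')%N by rewrite /p' /q'; nia.
have exq (u : nat) : excess (q' + u) = excess (q + d + u).
  have -> : (q' + u = q + d + u + (p + d.+1) * M)%N by rewrite /q'; lia.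
  by rewrite excessDMn.
have far (u : nat) : - D <= excess (q' + u) - excess (p' + u).
  by have := qmax (p' + u)%N; have := pmin (q' + u)%N; rewrite /D; lra.
have near (u : nat) : (u < M)%N -> (u <= d)%N || (M - d <= u)%N ->
    D - 2 * N * d%:R / M%:R <= excess (q' + u) - excess (p' + u).
  move=> uM /orP[ud|ud].
    have h1 := excessD q (d + u); rewrite addnA -exq in h1.
    have h2 := excessD (p' + u) (d - u).
    have E2 : (p' + u + (d - u) = p + d * M)%N by rewrite /p'; lia.
    rewrite E2 excessDMn in h2.
    rewrite natrD in h1; rewrite natrB// in h2; rewrite /D; lra.
  have h1 := excessD (q + M) (d + u - M).
  have E1 : (q + M + (d + u - M) = q + d + u)%N by lia.
  rewrite E1 -exq excessDM in h1.
  have h2 := excessD (p' + u) (M + d - u).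
  have E2 : (p' + u + (M + d - u) = p + d.+1 * M)%N by rewrite /p'; lia.
  rewrite E2 excessDMn in h2.
  have hh1 : (d + u - M)%N%:R = d%:R + u%:R - M%:R :> R by rewrite natrB ?natrD//; lia.
  have hh2 : (M + d - u)%N%:R = M%:R + d%:R - u%:R :> R by rewrite natrB ?natrD//; lia.
  have e1 : N * (d%:R + u%:R - M%:R) / M%:R = N * (d%:R + u%:R) / M%:R - N.
    by field; rewrite gt_eqF.
  have e2 : N * (M%:R + d%:R - u%:R) / M%:R = N * (d%:R - u%:R) / M%:R + N.
    by field; rewrite gt_eqF.
  rewrite hh1 e1 in h1; rewrite hh2 e2 in h2; rewrite /D; lra.
have sm := smoothed_excess_le pq.
have J1 : (0 < J)%N by rewrite ltnW.
have K0 := @fker_ge0 R M J J1 JM.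
have K1 := @sum_fker R M J J1 JM.
pose tau : R := \sum_(d.+1 <= u < M - d) K u.
have tau8 : tau <= 1 / 8.
  apply: le_trans (fker_tail R J1 JM d0) _; rewrite /d ML !natrM.
  have LR : 0 < L%:R :> R by rewrite ltr0n.
  rewrite le_eqVlt; apply/orP; left; apply/eqP; field.
  by rewrite !gt_eqF.
pose B : R := D - 2 * N * d%:R / M%:R.
have lower : B * (1 - tau) - D * tau <=
    \sum_(u < M) K u * (excess (q' + u) - excess (p' + u)).
  pose nr (u : nat) := (u <= d)%N || (M - d <= u)%N.
  have split_tau : tau = \sum_(u < M | ~~ nr u) K u.
    rewrite /tau (big_nat_widen d.+1 (M - d) M) ?leq_subr//.
    rewrite (big_nat_widenl d.+1 0)//= big_mkord.
    by apply: eq_bigl => u; rewrite /nr; lia.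
  have split1 : 1 - tau = \sum_(u < M | nr u) K u.
    by rewrite -K1 (bigID (fun u : 'I_M => nr u))/= -split_tau addrK.
  rewrite split1 split_tau [leRHS](bigID (fun u : 'I_M => nr u))/= !mulr_sumr -sumrN.
  apply: lerD; apply: ler_sum => u nu.
    by rewrite mulrC ler_wpM2l ?K0 ?near.
  by rewrite -mulNr mulrC ler_wpM2l ?K0 ?far.
have BE : B = D - 32 * N / J%:R.
  have LR : 0 < L%:R :> R by rewrite ltr0n.
  by rewrite /B /d ML !natrM; field; rewrite !gt_eqF.
have tau0 : 0 <= tau.
  rewrite /tau big_nat_cond sumr_ge0// => u /andP[/andP[_ ud] _]; apply: K0; lia.
have N0 : 0 <= N / J%:R by rewrite divr_ge0.
have := le_trans lower sm; rewrite BE.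
have -> : 32 * N / J%:R = 32 * (N / J%:R) by ring.
have h1 : 0 <= D * (1 / 8 - tau) by rewrite mulr_ge0// subr_ge0.
have h2 := mulr_ge0 N0 tau0.
move: (2 * _) (N / J%:R) h2 => S x h2 h3; lra.
Qed.

End ErdosTuran.

(** * From residues to real numbers modulo 1 *)

Section Continuous.
Variable R : realType.
Implicit Types (Y : seq R) (y : R).

Lemma lipschitz1_of_derive (f df : R -> R) (a b : R) :
  (forall x : R, is_derive x 1 f (df x)) -> (forall x, `|df x| <= 1) ->
  `|f a - f b| <= `|a - b|.
Proof.
move=> fd d1; wlog ab : a b / a < b.
  move=> H; have [/H//|/H|->] := ltgtP a b; last by rewrite !subrr.
  by rewrite distrC [leRHS]distrC.
have [c _ E] := is_derive_MVT ab fd.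
by rewrite distrC E normrM [leRHS]distrC ler_piMl.
Qed.

Lemma cos_lipschitz (a b : R) : `|cos a - cos b| <= `|a - b|.
Proof.
by apply: lipschitz1_of_derive => x; rewrite normrN sin_max.
Qed.

Lemma sin_lipschitz (a b : R) : `|sin a - sin b| <= `|a - b|.
Proof. by apply: lipschitz1_of_derive => x; exact: cos_max. Qed.

Lemma cosD2piz (x : R) (k : int) : cos (x + 2 * pi * k%:~R) = cos x.
Proof.
case: k => n; first exact: cosD2pin.
by rewrite NegzE rmorphN/= mulrN -(cosD2pin (_ - _) n.+1) subrK.
Qed.

Lemma sinD2piz (x : R) (k : int) : sin (x + 2 * pi * k%:~R) = sin x.
Proof.
case: k => n; first exact: sinD2pin.
by rewrite NegzE rmorphN/= mulrN -(sinD2pin (_ - _) n.+1) subrK.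
Qed.

Definition weyl_sum Y (j : nat) : R :=
  Num.sqrt ((\sum_(y <- Y) cos (2 * pi * j%:R * y)) ^+ 2 +
            (\sum_(y <- Y) sin (2 * pi * j%:R * y)) ^+ 2).

Lemma frac_itv y : 0 <= Defs.frac y < 1.
Proof.
have /andP[h1 h2] := floor_itv y; rewrite rmorphD/= in h2.
by rewrite /Defs.frac subr_ge0 h1 /= ltrBlDr addrC.
Qed.

Definition cell (M : nat) y : nat := Num.truncn (M%:R * Defs.frac y).

Lemma cell_itv M y : (cell M y)%:R <= M%:R * Defs.frac y < (cell M y)%:R + 1.
Proof.
rewrite natr1; apply: truncn_itv.
by rewrite mulr_ge0//; case/andP: (frac_itv y).
Qed.

Lemma cell_lt M y : (0 < M)%N -> (cell M y < M)%N.
Proof.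
move=> M0; rewrite -(ltr_nat R); have /andP[h _] := cell_itv M y.
apply: le_lt_trans h _; rewrite gtr_pMr ?ltr0n//.
by case/andP: (frac_itv y).
Qed.

Lemma sum_lipschitz_cell M Y j (f : R -> R) : (0 < M)%N ->
  (forall a b, `|f a - f b| <= `|a - b|) ->
  (forall x (k : int), f (x + 2 * pi * k%:~R) = f x) ->
  `|\sum_(n <- map (cell M) Y) f (j%:R * (n%:R * mesh_angle R M)) -
    \sum_(y <- Y) f (2 * pi * j%:R * y)| <= (size Y)%:R * (8 * j%:R / M%:R).
Proof.
move=> M0 fL fP; have MR : 0 < M%:R :> R by rewrite ltr0n.
rewrite big_map -sumrB; apply: le_trans (ler_norm_sum _ _ _) _.
rewrite -sum1_size natr_sum mulr_suml; apply: ler_sum => y _; rewrite mul1r.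
have -> : 2 * pi * j%:R * y = 2 * pi * j%:R * Defs.frac y + 2 * pi * (j%:Z * Num.floor y)%:~R.
  by rewrite /Defs.frac intrM; ring.
rewrite fP; apply: le_trans (fL _ _) _.
have /andP[h1 h2] := cell_itv M y.
have -> : j%:R * ((cell M y)%:R * mesh_angle R M) - 2 * pi * j%:R * Defs.frac y =
  - (2 * pi * j%:R / M%:R) * (M%:R * Defs.frac y - (cell M y)%:R).
  by rewrite /mesh_angle; field; rewrite gt_eqF.
have pi0 := pi_gt0 R; have pi4 := pihalf_lt2 R.
have e0 : 0 <= 2 * pi * j%:R / M%:R :> R.
  by rewrite divr_ge0 ?(ltW MR)// mulr_ge0// mulr_ge0// ltW.
have e1 : 0 <= M%:R * Defs.frac y - (cell M y)%:R by rewrite subr_ge0.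
rewrite normrM normrN (ger0_norm e0) (ger0_norm e1).
apply: (@le_trans _ _ (2 * pi * j%:R / M%:R * 1)).
  by rewrite ler_wpM2l//; lra.
rewrite mulr1 ler_wpM2r ?invr_ge0// ler_wpM2r//; lra.
Qed.

Lemma expsum_cell_le M Y j : (0 < M)%N ->
  expsum R M (map (cell M) Y) j <= weyl_sum Y j + 2 * ((size Y)%:R * (8 * j%:R / M%:R)).
Proof.
move=> M0.
have := @sum_lipschitz_cell M Y j cos M0 cos_lipschitz cosD2piz.
have := @sum_lipschitz_cell M Y j sin M0 sin_lipschitz sinD2piz.
rewrite /expsum /weyl_sum.
set C := \sum_(y <- Y) cos _; set S := \sum_(y <- Y) sin _.
set C' := \sum_(n <- _) cos _; set S' := \sum_(n <- _) sin _.
set h := _ * (8 * _ / _); move=> hS hC.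
have h0 : 0 <= h := le_trans (normr_ge0 _) hC.
set r := Num.sqrt (C ^+ 2 + S ^+ 2).
have r0 : 0 <= r by rewrite sqrtr_ge0.
have r2 : r ^+ 2 = C ^+ 2 + S ^+ 2 by rewrite sqr_sqrtr// addr_ge0 ?sqr_ge0.
have Cr : `|C| <= r by rewrite -sqrtr_sqr ler_wsqrtr// lerDl sqr_ge0.
have Sr : `|S| <= r by rewrite -sqrtr_sqr ler_wsqrtr// lerDr sqr_ge0.
have sq (u v : R) : `|u - v| <= h -> `|v| <= r -> u ^+ 2 <= v ^+ 2 + 2 * h * r + h ^+ 2.
  move=> uv vr; have nv := normr_ge0 v.
  have : `|u| <= `|v| + h.
    by rewrite -[u](subrK v); apply: le_trans (ler_normD _ _) _; rewrite addrC lerD2l.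
  move=> uh.
  have : `|u| ^+ 2 <= (`|v| + h) ^+ 2 by rewrite lerXn2r ?nnegrE// addr_ge0.
  rewrite !real_normK ?num_real// => hh; apply: (le_trans hh).
  have -> : (`|v| + h) ^+ 2 = `|v| ^+ 2 + 2 * h * `|v| + h ^+ 2 by ring.
  by rewrite real_normK ?num_real// lerD2r lerD2l ler_wpM2l// mulr_ge0.
have := sq _ _ hC Cr; have := sq _ _ hS Sr => s1 s2.
have R0 : 0 <= r + 2 * h by rewrite addr_ge0// mulr_ge0.
rewrite -[leRHS](ger0_norm R0) -sqrtr_sqr ler_wsqrtr//.
have -> : (r + 2 * h) ^+ 2 = r ^+ 2 + 4 * h * r + 4 * h ^+ 2 by ring.
rewrite r2; have := sqr_ge0 h; lra.
Qed.

Lemma sum_hits_itv M (ns : seq nat) p q : (q <= M)%N ->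
  \sum_(p <= u < q) hits R M ns u = (count (fun n => p <= n < q)%N ns)%:R.
Proof.
move=> qM.
rewrite big_nat_cond (eq_bigr (fun u => \sum_(n <- ns) (n == u)%N%:R)); last first.
  move=> u /andP[/andP[_ uq] _]; rewrite hitsE modn_small//.
  exact: leq_trans uq qM.
rewrite exchange_big/= -sum1_count natr_sum [RHS]big_mkcond; apply: eq_bigr => n _.
rewrite -big_nat_cond; case: ifP => nq.
  rewrite (bigD1_seq n) ?mem_index_iota ?iota_uniq//= eqxx big1 ?addr0// => u un.
  by rewrite eq_sym (negbTE un).
rewrite big1_seq// => u; rewrite mem_index_iota /= => uq.
by case: eqP => // E; rewrite E uq in nq.
Qed.

(** The interval [a, b] is covered by a run of cells and contains the run without its two end cells;
    each end costs at most 1 / M. *)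
Lemma discrepancy_le_excess M Y (D : R) : (0 < M)%N -> (0 < size Y)%N ->
  (forall s t, excess R M (map (cell M) Y) s - excess R M (map (cell M) Y) t <= D) ->
  discrepancy Y <= 2 / M%:R + D / (size Y)%:R.
Proof.
move=> M0 Y0 hD; have MR : 0 < M%:R :> R by rewrite ltr0n.
have NR : 0 < (size Y)%:R :> R by rewrite ltr0n.
set ns := map (cell M) Y in hD *.
have D0 : 0 <= D by have := hD 0%N 0%N; rewrite subrr.
have szn : size ns = size Y by rewrite size_map.
have exE p q : (p <= q)%N -> \sum_(p <= u < q) hits R M ns u =
    excess R M ns q - excess R M ns p + (size Y)%:R * (q%:R - p%:R) / M%:R.
  move=> pq; rewrite /excess szn -!(big_mkord xpredT (hits R M ns)).
  by rewrite (@big_cat_nat _ _ _ p 0 q)//=; lra.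
apply: ge_sup; first by have [] := has_sup_deviations Y.
move=> _ [a [b [a0 ab b1 ->]]].
have Ma0 : 0 <= M%:R * a by rewrite mulr_ge0.
have Mb0 : 0 <= M%:R * b by rewrite mulr_ge0// (le_trans a0).
pose p := Num.truncn (M%:R * a); pose q := Num.truncn (M%:R * b).
have /andP[pa1 pa2] : p%:R <= M%:R * a < p%:R + 1 by rewrite natr1; exact: truncn_itv.
have /andP[qb1 qb2] : q%:R <= M%:R * b < q%:R + 1 by rewrite natr1; exact: truncn_itv.
have qM : (q <= M)%N by rewrite -(ler_nat R); apply: le_trans qb1 _; rewrite ler_piMr.
have pq : (p <= q)%N by apply: le_truncn; rewrite ler_wpM2l.
rewrite /prop_in; set c := count _ Y.
have cnt_map P : (count P ns = count (fun y => P (cell M y)) Y)%N by rewrite count_map.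
have cup : c%:R <= D + (size Y)%:R * (b - a + 2 / M%:R).
  (* For b = 1 one has q = M, which is not the index of a cell. *)
  pose q1 := minn M q.+1.
  have pq1 : (p <= q1)%N by rewrite leq_min (leq_trans pq qM) ltnW.
  have q1q : q1%:R <= M%:R * b + 1.
    by apply: (@le_trans _ _ (q%:R + 1)); [rewrite natr1 ler_nat geq_minr|lra].
  apply: (@le_trans _ _ (\sum_(p <= u < q1) hits R M ns u)).
    rewrite sum_hits_itv ?geq_minl// cnt_map ler_nat; apply: sub_count => y /= /andP[ya yb].
    have /andP[c1 c2] := cell_itv M y.
    rewrite leq_min cell_lt//= ltnS; apply/andP; split; last first.
      by apply: le_truncn; rewrite ler_wpM2l.
    by apply: le_truncn; rewrite ler_wpM2l.
  rewrite exE// lerD// -mulrA ler_wpM2l// ler_pdivrMr// mulrDl divfK ?gt_eqF//; lra.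
have clo : (size Y)%:R * (b - a - 2 / M%:R) - D <= c%:R.
  have [p1q|qp1] := leqP p.+1 q; last first.
    have : b - a - 2 / M%:R <= 0.
      have : q%:R < p%:R + 1 :> R by rewrite natr1 ltr_nat.
      move=> h; rewrite subr_le0 ler_pdivlMr//; lra.
    move=> h; apply: (@le_trans _ _ 0); last by [].
    have : (size Y)%:R * (b - a - 2 / M%:R) <= 0 by rewrite mulr_ge0_le0.
    lra.
  apply: (@le_trans _ _ (\sum_(p.+1 <= u < q) hits R M ns u)); last first.
    rewrite sum_hits_itv// cnt_map ler_nat; apply: sub_count => y /= /andP[ya yb].
    have /andP[c1 c2] := cell_itv M y.
    have h1 : p%:R + 1 <= (cell M y)%:R :> R by rewrite natr1 ler_nat.
    have h2 : (cell M y)%:R + 1 <= q%:R :> R by rewrite natr1 ler_nat.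
    apply/andP; split; rewrite -(ler_pM2l MR); lra.
  rewrite exE//; have := hD p.+1 q => h.
  have -> : (size Y)%:R * (q%:R - p.+1%:R) / M%:R = (size Y)%:R * ((q%:R - p.+1%:R) / M%:R) :> R by ring.
  have : (size Y)%:R * (b - a - 2 / M%:R) <= (size Y)%:R * ((q%:R - p.+1%:R) / M%:R).
    rewrite ler_wpM2l// ler_pdivlMr// mulrBl divfK ?gt_eqF// -[p.+1%:R]natr1; lra.
  lra.
rewrite ler_norml; apply/andP; split.
  rewrite lerBrDr ler_pdivlMr// mulrDl mulNr mulrDl divfK ?gt_eqF//; lra.
rewrite lerBlDr ler_pdivrMr// !mulrDl divfK ?gt_eqF//; lra.
Qed.

Theorem erdos_turan Y J : (1 < J)%N -> (0 < size Y)%N ->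
  discrepancy Y <= 100 / J%:R +
    8 / 3 * \sum_(j < J) weyl_sum Y j.+1 / j.+1%:R / (size Y)%:R.
Proof.
(* With M = 8 J^2, rounding the points to cells changes the bound by O(1 / J) only. *)
move=> J1 Y0; pose L := (8 * J)%N; pose M := (J * L)%N.
have L0 : (0 < L)%N by rewrite /L; lia.
have JM : (2 * J <= M)%N by rewrite /M /L; nia.
have M0 : (0 < M)%N by rewrite /M; nia.
have JR : 0 < J%:R :> R by rewrite ltr0n ltnW.
have NR : 0 < (size Y)%:R :> R by rewrite ltr0n.
have ME : M%:R = 8 * J%:R * J%:R :> R by rewrite /M /L !natrM; ring.
have MR : 0 < M%:R :> R by rewrite ltr0n.
have nsM : all (fun n => n < M)%N (map (cell M) Y).
  by apply/allP => _ /mapP[y _ ->]; exact: cell_lt.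
pose W := \sum_(j < J) weyl_sum Y j.+1 / j.+1%:R.
have ET s t := @erdos_turan_discrete R M J L _ J1 L0 erefl JM nsM s t.
rewrite size_map in ET.
have sumle : \sum_(j < J) expsum R M (map (cell M) Y) j.+1 / j.+1%:R <=
    W + J%:R * (2 * ((size Y)%:R * (8 / M%:R))).
  rewrite -[J in J%:R * _]card_ord mulr_natl -sumr_const -big_split/=.
  apply: ler_sum => j _; have jR : 0 < j.+1%:R :> R by [].
  rewrite ler_pdivrMr//; apply: le_trans (expsum_cell_le _ _ M0) _.
  rewrite [leRHS]mulrDl (divfK (lt0r_neq0 jR)) lerD2l.
  by rewrite le_eqVlt; apply/orP; left; apply/eqP; ring.
pose D : R := 4 / 3 * (2 * (W + J%:R * (2 * ((size Y)%:R * (8 / M%:R)))) + 32 * (size Y)%:R / J%:R).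
apply: le_trans (@discrepancy_le_excess M Y D M0 Y0 _) _.
  by move=> s t; have := ET s t; rewrite /D; lra.
rewrite -mulr_suml -/W.
have -> : D / (size Y)%:R = 8 / 3 * (W / (size Y)%:R) + (48 / J%:R + 0).
  rewrite /D ME addr0.
  have -> : 48 / J%:R = 4 / 3 * (2 * (J%:R * (2 * (8 / (8 * J%:R * J%:R)))) + 32 / J%:R) :> R.
    by field; rewrite gt_eqF.
  by field; rewrite !gt_eqF.
rewrite addr0 addrCA addrC lerD2r.
have -> : 100 / J%:R = 52 / J%:R + 48 / J%:R :> R by field; rewrite gt_eqF.
rewrite lerD2r ME.
have J2 : 1 <= J%:R :> R by rewrite ler1n ltnW.
have -> : 2 / (8 * J%:R * J%:R) = (1 / (4 * J%:R)) / J%:R :> R by field; rewrite gt_eqF.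
rewrite ler_wpM2r ?invr_ge0 ?(ltW JR)// ler_pdivrMr; lra.
Qed.

End Continuous.

(** * Parity vectors and the random walk of the logarithms *)

Lemma collatzT_even (a : int) : collatzT (2 * a) = a.
Proof. by rewrite /collatzT dvdz_mulr// mulKz. Qed.

Lemma collatzT_odd (a : int) : collatzT (2 * a + 1) = 3 * a + 2.
Proof.
rewrite /collatzT ifF; last by apply/negbTE; lia.
have -> : 3 * (2 * a + 1) + 1 = 2 * (3 * a + 2) :> int by ring.
by rewrite mulKz.
Qed.

Fixpoint parities (n : nat) (x : int) : seq bool :=
  if n is n'.+1 then ~~ (2 %| x)%Z :: parities n' (collatzT x) else [::].

Lemma sum_double (R : nmodType) (F : nat -> R) k :
  \sum_(y < 2 * k) F y = \sum_(z < k) (F (2 * z)%N + F (2 * z + 1)%N).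
Proof.
elim: k => [|k IH]; first by rewrite muln0 !big_ord0.
rewrite mulnS [in LHS](addnC 2) addn2 !big_ord_recr /= IH addrA; congr (_ + _ + _).
by rewrite addn1.
Qed.

Section Walk.
Variable R : realType.

Fixpoint bsum (n : nat) (f : seq bool -> R) : R :=
  if n is n'.+1 then bsum n' (fun e => f (false :: e)) + bsum n' (fun e => f (true :: e))
  else f [::].

(* The 2^n terms of an arithmetic progression with odd difference realise every
   parity vector exactly once; the induction turns the progression into two of
   half the length, of differences [g] and [3 g]. *)
Lemma sum_parities n (r g : int) (f : seq bool -> R) : ~~ (2 %| g)%Z ->
  \sum_(y < 2 ^ n) f (parities n (r + g * y%:Z)) = bsum n f.
Proof.
elim: n r g f => [|n IH] r g f g2.
  by rewrite big_ord_recl big_ord0 addr0.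
rewrite expnS (sum_double (fun y => f (parities n.+1 (r + g * y%:Z)))).
have g3 : ~~ (2 %| 3 * g)%Z by lia.
have [r2|r2] := boolP (2 %| r)%Z.
  have [a ra] : exists a, r = 2 * a by exists (r %/ 2)%Z; lia.
  have [b gb] : exists b, g = 2 * b + 1 by exists ((g - 1) %/ 2)%Z; lia.
  rewrite big_split/=; congr (_ + _).
    rewrite -(IH a g)//; apply: eq_bigr => z _.
    have -> : r + g * (2 * z)%N%:Z = 2 * (a + g * z%:Z) by rewrite ra PoszM; ring.
    by rewrite collatzT_even dvdz_mulr.
  rewrite -(IH (3 * (a + b) + 2) (3 * g))//; apply: eq_bigr => z _.
  have -> : r + g * (2 * z + 1)%N%:Z = 2 * (a + b + g * z%:Z) + 1.
    by rewrite ra PoszD PoszM gb; ring.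
  rewrite collatzT_odd; congr (f (_ :: parities n _)); last by ring.
  by lia.
have [a ra] : exists a, r = 2 * a + 1 by exists ((r - 1) %/ 2)%Z; lia.
have [b gb] : exists b, g = 2 * b + 1 by exists ((g - 1) %/ 2)%Z; lia.
rewrite big_split/= addrC; congr (_ + _).
  rewrite -(IH (a + b + 1) g)//; apply: eq_bigr => z _.
  have -> : r + g * (2 * z + 1)%N%:Z = 2 * (a + b + 1 + g * z%:Z).
    by rewrite ra PoszD PoszM gb; ring.
  by rewrite collatzT_even dvdz_mulr.
rewrite -(IH (3 * a + 2) (3 * g))//; apply: eq_bigr => z _.
have -> : r + g * (2 * z)%N%:Z = 2 * (a + g * z%:Z) + 1 by rewrite ra PoszM; ring.
rewrite collatzT_odd; congr (f (_ :: parities n _)); last by ring.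
by lia.
Qed.

Lemma eq_bsum n f g : f =1 g -> bsum n f = bsum n g.
Proof.
by elim: n f g => [|n IH] f g fg /=; rewrite ?fg//; congr (_ + _); apply: IH.
Qed.

Lemma bsumD n f g : bsum n (fun e => f e + g e) = bsum n f + bsum n g.
Proof. by elim: n f g => [|n IH] f g //=; rewrite !IH addrACA. Qed.

Lemma bsumM n (c : R) f : bsum n (fun e => c * f e) = c * bsum n f.
Proof. by elim: n f => [|n IH] f //=; rewrite !IH mulrDr. Qed.

Lemma bsum_cst n (c : R) : bsum n (fun=> c) = 2 ^+ n * c.
Proof.
elim: n => [|n IH]; first by rewrite mul1r.
by rewrite /= !IH exprS; ring.
Qed.

Definition step (b : bool) : R := if b then ln 3 - ln 2 else - ln 2.

Arguments step : simpl never.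

(** For f = cos and f = sin these are the real and imaginary parts of the Weyl sum of the ideal
    walk, in which the 1 of 3x + 1 is ignored; [th] is the starting angle. *)
Fixpoint tsum (f : R -> R) (k th : R) (e : seq bool) : R :=
  if e is b :: e' then f (th + k * step b) + tsum f k (th + k * step b) e' else 0.

Definition phi_re k := (cos (k * step false) + cos (k * step true)) / 2.
Definition phi_im k := (sin (k * step false) + sin (k * step true)) / 2.

(* [walk_mean k n] is [phi + phi^2 + ... + phi^n] with
   [phi = phi_re k + i * phi_im k]. *)
Fixpoint walk_mean k n : R * R :=
  if n is n'.+1 then
    let z := walk_mean k n' in
    (phi_re k * (1 + z.1) - phi_im k * z.2, phi_re k * z.2 + phi_im k * (1 + z.1))
  else (0, 0).

(** Independent steps: the mean of e^(ikS_t) is phi^t, and the starting angle factors out as e^(i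
    th). *)
Lemma bsum_tsum k n th : let z := walk_mean k n in
  bsum n (tsum cos k th) = 2 ^+ n * (z.1 * cos th - z.2 * sin th) /\
  bsum n (tsum sin k th) = 2 ^+ n * (z.1 * sin th + z.2 * cos th).
Proof.
elim: n th => [|n IH] th /=; first by split; ring.
rewrite !bsumD !bsum_cst.
have [-> ->] := IH (th + k * step false).
have [-> ->] := IH (th + k * step true).
rewrite /phi_re /phi_im !cosD !sinD exprS.
by split; field.
Qed.

Lemma phi_norm_le1 k : phi_re k ^+ 2 + phi_im k ^+ 2 <= 1.
Proof.
rewrite /phi_re /phi_im.
move: (k * step false) (k * step true) => a b.
have := cos2Dsin2 a; have := cos2Dsin2 b; have := cos_le1 (a - b).
rewrite cosB !expr2; lra.
Qed.

(** A geometric series: the modulus is |phi - phi^(n+1)| / |1 - phi|, at most 2 / |1 - phi|. *)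
Lemma walk_mean_le k n : phi_re k < 1 ->
  (walk_mean k n).1 <= 2 / (1 - phi_re k).
Proof.
move=> p1; have pn := phi_norm_le1 k.
set p := phi_re k in p1 pn *; set r := phi_im k in pn *.
(* [t1] and [t2] are the real and imaginary parts of phi - (1 - phi) z, which at [walk_mean k n]
   equals phi^(n+1). *)
pose t1 (z : R * R) := p - ((1 - p) * z.1 + r * z.2).
pose t2 (z : R * R) := r - ((1 - p) * z.2 - r * z.1).
have T : t1 (walk_mean k n) ^+ 2 + t2 (walk_mean k n) ^+ 2 <= 1.
  elim: n => [|n IH].
    by rewrite /t1 /t2 /= !mulr0 addr0 subr0 !subr0.
  set z := walk_mean k n in IH.
  have e1 : t1 (walk_mean k n.+1) = p * t1 z - r * t2 z.
    by rewrite /t1 /t2 /= -/z -/p -/r; ring.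
  have e2 : t2 (walk_mean k n.+1) = p * t2 z + r * t1 z.
    by rewrite /t1 /t2 /= -/z -/p -/r; ring.
  rewrite e1 e2.
  have -> : (p * t1 z - r * t2 z) ^+ 2 + (p * t2 z + r * t1 z) ^+ 2 =
    (p ^+ 2 + r ^+ 2) * (t1 z ^+ 2 + t2 z ^+ 2) by ring.
  by apply: mulr_ile1; rewrite ?addr_ge0 ?sqr_ge0.
set z := walk_mean k n in T *.
have q0 : 0 < 1 - p by rewrite subr_gt0.
rewrite ler_pdivlMr// leNgt; apply/negP => h.
have E : (z.1 ^+ 2 + z.2 ^+ 2) * ((1 - p) ^+ 2 + r ^+ 2) = (p - t1 z) ^+ 2 + (r - t2 z) ^+ 2.
  by rewrite /t1 /t2; ring.
have u1 : (p - t1 z) ^+ 2 + (r - t2 z) ^+ 2 <= 4.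
  have := sqr_ge0 (p + t1 z); have := sqr_ge0 (r + t2 z).
  move: T pn; rewrite !expr2; lra.
have l1 : (z.1 * (1 - p)) ^+ 2 <= (z.1 ^+ 2 + z.2 ^+ 2) * ((1 - p) ^+ 2 + r ^+ 2).
  have -> : (z.1 ^+ 2 + z.2 ^+ 2) * ((1 - p) ^+ 2 + r ^+ 2) = (z.1 * (1 - p)) ^+ 2 +
    (z.1 ^+ 2 * r ^+ 2 + z.2 ^+ 2 * (1 - p) ^+ 2 + z.2 ^+ 2 * r ^+ 2) by ring.
  by rewrite lerDl !addr_ge0// mulr_ge0 ?sqr_ge0.
have : 2 ^+ 2 < (z.1 * (1 - p)) ^+ 2 by rewrite ltrXn2r.
rewrite E in l1; lra.
Qed.

(** Split off the first term: |e^(iu) + W|^2 = 1 + 2 Re(e^(-iu) W) + |W|^2, where the cross term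
    averages to [walk_mean]. So each step adds at most 1 + 4 / (1 - Re phi) <= 6 / (1 - Re phi),
    because 1 - Re phi <= 2. *)
Lemma walk_second_moment k n th : phi_re k < 1 ->
  bsum n (fun e => tsum cos k th e ^+ 2 + tsum sin k th e ^+ 2) <=
  2 ^+ n * (6 * n%:R / (1 - phi_re k)).
Proof.
move=> p1; have q0 : 0 < 1 - phi_re k by rewrite subr_gt0.
elim: n th => [|n IH] th /=; first by rewrite expr0n/= addr0 mulr0 mul0r mulr0.
have [bc bs] := bsum_tsum k n (th + k * step false).
have [bc' bs'] := bsum_tsum k n (th + k * step true).
have ex (b : bool) : bsum n (fun e =>
    (cos (th + k * step b) + tsum cos k (th + k * step b) e) ^+ 2 +
    (sin (th + k * step b) + tsum sin k (th + k * step b) e) ^+ 2) =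
  2 ^+ n * (1 + 2 * (walk_mean k n).1) +
  bsum n (fun e => tsum cos k (th + k * step b) e ^+ 2 + tsum sin k (th + k * step b) e ^+ 2).
  set u := th + k * step b.
  rewrite (@eq_bsum _ _ (fun e => (1 + (2 * cos u * tsum cos k u e + 2 * sin u * tsum sin k u e))
     + (tsum cos k u e ^+ 2 + tsum sin k u e ^+ 2))); last first.
    by move=> e; have := cos2Dsin2 u; rewrite !expr2; lra.
  rewrite !bsumD bsum_cst !bsumM.
  have [-> ->] := bsum_tsum k n u; congr (_ + _).
  have := cos2Dsin2 u; rewrite !expr2 => h.
  transitivity (2 ^+ n * (1 + 2 * (walk_mean k n).1 * (cos u * cos u + sin u * sin u))); first ring.
  by rewrite h mulr1.
rewrite !ex.
have := IH (th + k * step false); have := IH (th + k * step true).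
have wm := walk_mean_le n p1.
have p2 : 1 <= 2 / (1 - phi_re k).
  rewrite ler_pdivlMr// mul1r /phi_re; have := cos_geN1 (k * step false).
  have := cos_geN1 (k * step true); lra.
have e0 : 0 <= 2 ^+ n :> R by rewrite exprn_ge0.
have key : 2 ^+ n * (1 + 2 * (walk_mean k n).1) <= 2 ^+ n * (6 / (1 - phi_re k)).
  rewrite ler_wpM2l//.
  have -> : 6 / (1 - phi_re k) = 2 / (1 - phi_re k) + 2 * (2 / (1 - phi_re k)) by field; lra.
  lra.
have -> : 2 ^+ n.+1 * (6 * n.+1%:R / (1 - phi_re k)) =
   2 * (2 ^+ n * (6 / (1 - phi_re k))) + 2 * (2 ^+ n * (6 * n%:R / (1 - phi_re k))).
  by rewrite exprS -[n.+1%:R]natr1; field; rewrite gt_eqF.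
lra.
Qed.

(** The sum of e^(-S_i) over 0 <= i < n, with S_i the walk after i steps. As x_i >= x_0 e^(S_i),
    [zerr] / (3 x_0) bounds the sum of the errors 1 / (3 x_i) made by ignoring the 1 in 3x + 1. *)
Fixpoint zerr (e : seq bool) : R :=
  if e is b :: e' then 1 + expR (- step b) * zerr e' else 0.

Lemma zerr_ge0 e : 0 <= zerr e.
Proof. by elim: e => //= b e IH; rewrite addr_ge0// mulr_ge0// expR_ge0. Qed.

Lemma expR_step b : expR (step b) = if b then 3 / 2 else 1 / 2.
Proof.
case: b; rewrite /step ?expRB ?expRN !lnK ?posrE//.
by rewrite mul1r.
Qed.

(** The mean of e^(-step) is (2 + 2/3) / 2 = 4/3, so this is 2^n times a geometric sum of ratio
    4/3. *)
Lemma bsum_zerr n : bsum n zerr <= 3 * (8 / 3) ^+ n.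
Proof.
suff -> : bsum n zerr = 3 * ((8 / 3) ^+ n - 2 ^+ n).
  by rewrite ler_wpM2l// gerBl exprn_ge0.
elim: n => [|n IH]; first by rewrite /= !expr0 subrr mulr0.
have e0 : expR (- step false) = 2 by rewrite expRN expR_step; field.
have e1 : expR (- step true) = 2 / 3 by rewrite expRN expR_step; field.
rewrite /= !bsumD !bsum_cst !bsumM IH e0 e1 !(exprS _ n).
by move: ((8 / 3) ^+ n) (2 ^+ n) => a b; field.
Qed.

Fixpoint asum (F : int -> R) n (x : int) : R :=
  if n is n'.+1 then F (collatzT x) + asum F n' (collatzT x) else 0.

Lemma asumE F n x : \sum_(k <- iota 1 n) F (iter k collatzT x) = asum F n x.
Proof.
elim: n x => [|n IH] x; first by rewrite big_nil.
rewrite /= big_cons /= -IH -[iota 2 n]/(iota (1 + 1) n) iotaDl big_map.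
by congr (_ + _); apply: eq_bigr => k _; rewrite add1n iterSr.
Qed.

Lemma collatz_step (x : int) (b := ~~ (2 %| x)%Z) : 0 < x ->
  [/\ 0 < collatzT x,
      0 <= ln (collatzT x)%:~R - ln x%:~R - step b <= (3 * x%:~R)^-1 &
      x%:~R * expR (step b) <= (collatzT x)%:~R :> R].
Proof.
move=> x0; rewrite /b.
have xR : 0 < x%:~R :> R by rewrite ltr0z.
have [x2|x2] := boolP (2 %| x)%Z.
  have [a ra] : exists a, x = 2 * a by exists (x %/ 2)%Z; lia.
  have a0 : 0 < a by lia.
  have aR : 0 < a%:~R :> R by rewrite ltr0z.
  have xa : x%:~R = 2 * a%:~R :> R by rewrite ra intrM.
  rewrite ra collatzT_even -ra expR_step/= xa lnM ?posrE//.
  split => //; last by lra.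
  have -> : ln a%:~R - (ln 2 + ln a%:~R) - - ln 2 = 0 :> R by ring.
  by rewrite lexx invr_ge0; lra.
have [a ra] : exists a, x = 2 * a + 1 by exists ((x - 1) %/ 2)%Z; lia.
have a0 : 0 <= a by lia.
have -> : collatzT x = 3 * a + 2 by rewrite ra collatzT_odd.
rewrite expR_step/=.
have xa : (3 * a + 2)%:~R = x%:~R * (3 / 2) * (1 + (3 * x%:~R)^-1) :> R.
  rewrite ra !(intrD, intrM); field.
  have : 0 <= a%:~R :> R by rewrite ler0z.
  move=> ?; apply/negP => /eqP; lra.
split; first by lia.
- rewrite xa /step.
  have h1 : 0 < 1 + (3 * x%:~R)^-1 :> R by rewrite addr_gt0// invr_gt0 mulr_gt0.
  have h2 : 0 < 3 / 2 :> R by rewrite divr_gt0.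
  have h3 : 0 < x%:~R * (3 / 2) :> R by rewrite mulr_gt0.
  have -> : ln (x%:~R * (3 / 2) * (1 + (3 * x%:~R)^-1)) =
      ln x%:~R + (ln 3 - ln 2) + ln (1 + (3 * x%:~R)^-1) :> R.
    rewrite (lnM (h3 : _ \in Num.pos) (h1 : _ \in Num.pos)).
    rewrite (lnM (xR : _ \in Num.pos) (h2 : _ \in Num.pos)).
    by rewrite ln_div ?posrE.
  set v := ln (1 + (3 * x%:~R)^-1).
  have -> : ln x%:~R + (ln 3 - ln 2) + v - ln x%:~R - (ln 3 - ln 2) = v by ring.
  rewrite /v ln_ge0/=; last by rewrite lerDl invr_ge0 mulr_ge0// ltW.
  rewrite -ler_expR lnK ?posrE//; exact: expR_ge1Dx.
- have h2 : 0 <= (3 * x%:~R)^-1 :> R by rewrite invr_ge0 mulr_ge0// ltW.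
  have h3 : 0 <= x%:~R * (3 / 2) :> R by rewrite mulr_ge0 ?divr_ge0// ltW.
  by rewrite xa ler_peMr// lerDl.
Qed.

(** [h] is the angular error on entry. It grows by at most k / (3x) in a step, and its final value
    serves for all [n] terms. *)
Lemma asum_tsum_le (f : R -> R) (k : R) n (x : int) th h : 0 <= k -> 0 < x ->
  (forall u v, `|f u - f v| <= `|u - v|) ->
  `|k * ln x%:~R - th| <= h ->
  `|asum (fun y => f (k * ln y%:~R)) n x - tsum f k th (parities n x)| <=
  n%:R * (h + k * zerr (parities n x) / (3 * x%:~R)).
Proof.
move=> k0 + fL; elim: n x th h => [|n IH] x th h x0 hth.
  by rewrite /= subrr normr0 mul0r.
have [x0' /andP[l0 l1] xe] := collatz_step x0.
set b := ~~ (2 %| x)%Z in l0 l1 xe.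
have xR : 0 < x%:~R :> R by rewrite ltr0z.
have xR' : 0 < (collatzT x)%:~R :> R by rewrite ltr0z.
rewrite /= -/b; set x' := collatzT x in x0' l0 l1 xe xR' *.
set th' := th + k * step b; set e := parities n x'.
pose h' := h + k / (3 * x%:~R).
have hth' : `|k * ln x'%:~R - th'| <= h'.
  have -> : k * ln x'%:~R - th' = (k * ln x%:~R - th) + k * (ln x'%:~R - ln x%:~R - step b).
    by rewrite /th'; ring.
  apply: le_trans (ler_normD _ _) _; apply: lerD => //.
  by rewrite ger0_norm ?mulr_ge0// ler_wpM2l.
have := IH x' th' h' x0' hth'; rewrite -/e => IH'.
have ze := zerr_ge0 e.
have zle : h' + k * zerr e / (3 * x'%:~R) <= h + k * (1 + expR (- step b) * zerr e) / (3 * x%:~R).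
  have -> : h + k * (1 + expR (- step b) * zerr e) / (3 * x%:~R) =
      h' + k * (zerr e * (expR (- step b) / (3 * x%:~R))) by rewrite /h'; ring.
  rewrite lerD2l -mulrA ler_wpM2l// ler_wpM2l//.
  rewrite expRN -invfM lef_pV2 ?posrE ?mulr_gt0 ?expR_gt0//.
  have -> : expR (step b) * (3 * x%:~R) = 3 * (x%:~R * expR (step b)) by ring.
  by rewrite ler_wpM2l.
have h'le : h' <= h' + k * zerr e / (3 * x'%:~R).
  by rewrite lerDl divr_ge0 ?mulr_ge0// ltW.
set Bd := h + _ in zle *.
have -> : n.+1%:R * Bd = Bd + n%:R * Bd by rewrite -natr1; ring.
have -> : f (k * ln x'%:~R) + asum (fun y : int => f (k * ln y%:~R)) n x' -
   (f th' + tsum f k th' e) = (f (k * ln x'%:~R) - f th') +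
   (asum (fun y : int => f (k * ln y%:~R)) n x' - tsum f k th' e) by ring.
apply: le_trans (ler_normD _ _) _; apply: lerD.
  by apply: le_trans (fL _ _) _; apply: le_trans hth' _; apply: le_trans h'le zle.
by apply: le_trans IH' _; rewrite ler_wpM2l.
Qed.

Lemma asum_tsum_le2 (f : R -> R) (k : R) n (x : int) th :
  (forall u, `|f u| <= 1) ->
  `|asum (fun y => f (k * ln y%:~R)) n x - tsum f k th (parities n x)| <= 2 * n%:R.
Proof.
move=> f1; elim: n x th => [|n IH] x th; first by rewrite /= subrr normr0 mulr0.
rewrite /=; set th' := th + _.
have -> : 2 * n.+1%:R = 2 + 2 * n%:R :> R by rewrite -natr1; ring.
have := IH (collatzT x) th'.
set A := asum _ _ _; set T := tsum _ _ _ _; set u := f (k * _); set v := f th'.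
move=> IH'; have -> : u + A - (v + T) = (u - v) + (A - T) by ring.
apply: le_trans (ler_normD _ _) (lerD _ IH').
apply: le_trans (ler_normB _ _) _.
by have := lerD (f1 (k * ln (collatzT x)%:~R)) (f1 th'); rewrite -/u -/v; lra.
Qed.

End Walk.

(** * Lower bound for 1 - Re phi_j *)

Section Gap.
Variable R : realType.

Lemma cos_gap (x : R) : exists2 m : int, `|x - m%:~R| <= 1 / 2 &
  2 * (x - m%:~R) ^+ 2 <= 1 - cos (2 * pi * x).
Proof.
pose m := Num.floor (x + 1 / 2); exists m.
  have /andP[h1 h2] := floor_itv (x + 1 / 2); rewrite rmorphD/= -/m in h2.
  by rewrite ler_norml; apply/andP; split; move: h1; rewrite -/m; lra.
have dm : `|x - m%:~R| <= 1 / 2.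
  have /andP[h1 h2] := floor_itv (x + 1 / 2); rewrite rmorphD/= -/m in h2.
  by rewrite ler_norml; apply/andP; split; move: h1; rewrite -/m; lra.
set d := x - m%:~R in dm *.
have -> : 2 * pi * x = 2 * pi * d + 2 * pi * m%:~R by rewrite /d; ring.
rewrite cosD2piz.
have -> : 2 * pi * d = pi * d + pi * d by ring.
rewrite cosD; have := cos2Dsin2 (pi * d).
have sd : d ^+ 2 <= sin (pi * d) ^+ 2.
  have [d0|d0] := leP 0 d.
    rewrite ger0_norm// in dm.
    by rewrite lerXn2r ?nnegrE ?sinpi_ge// (le_trans d0 (sinpi_ge _ _)).
  rewrite ltr0_norm// in dm.
  have h : - d <= sin (pi * (- d)) by apply: sinpi_ge => //; rewrite oppr_ge0 ltW.
  rewrite mulrN sinN in h; rewrite -sqrrN -[leRHS]sqrrN lerXn2r ?nnegrE//.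
    by rewrite oppr_ge0 ltW.
  by rewrite (le_trans _ h)// oppr_ge0 ltW.
move: sd; rewrite !expr2; lra.
Qed.

Lemma phi_gap (B : nat) : (2 <= B)%N ->
  exists2 c : R, 0 < c & forall j, (0 < j)%N ->
    c / j%:R ^+ 32 <= 1 - phi_re (2 * pi * j%:R / ln B%:R).
Proof.
move=> B2; have [c0 c00 form] := log_form_lower_bound R.
have l2 : 0 < ln 2 :> R by rewrite ln_gt0// ltr1n.
have lB : ln 2 <= ln B%:R :> R by rewrite ler_ln ?posrE ?ltr0n ?ler_nat//; lia.
have lB0 : 0 < ln B%:R :> R := lt_le_trans l2 lB.
have l4 : ln 4 = ln 2 + ln 2 :> R by rewrite -lnM ?posrE//; congr ln; rewrite -natrM.
have l32 : 0 < ln 3 - ln 2 :> R by rewrite subr_gt0 ltr_ln ?posrE// ltr_nat.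
have l43 : 0 < ln 4 - ln 3 :> R by rewrite subr_gt0 ltr_ln ?posrE// ltr_nat.
have l21 : ln 2 <= 1 :> R.
  rewrite -[leRHS](expRK 1) ler_ln ?posrE ?expR_gt0//.
  exact: (expR_ge1Dx (1 : R)).
pose c1 := Num.min (c0 / 4 ^+ 16) (ln 2 / ln B%:R).
have c10 : 0 < c1 by rewrite lt_min divr_gt0 ?exprn_gt0//= divr_gt0.
exists (c1 ^+ 2 / 2); first by rewrite divr_gt0 ?exprn_gt0.
move=> j j0; have jR : 0 < j%:R :> R by rewrite ltr0n.
have j1 : 1 <= j%:R :> R by rewrite ler1n.
pose x1 : R := j%:R * (ln 2 / ln B%:R); pose x2 : R := j%:R * ((ln 3 - ln 2) / ln B%:R).
have [m1 d1 g1] := cos_gap x1; have [m2 d2 g2] := cos_gap x2.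
set e1 := x1 - m1%:~R in d1 g1; set e2 := x2 - m2%:~R in d2 g2.
have phiE : 1 - phi_re (2 * pi * j%:R / ln B%:R) =
    ((1 - cos (2 * pi * x1)) + (1 - cos (2 * pi * x2))) / 2.
  rewrite /phi_re /step.
  have -> : 2 * pi * j%:R / ln B%:R * - ln 2 = - (2 * pi * x1) by rewrite /x1; ring.
  have -> : 2 * pi * j%:R / ln B%:R * (ln 3 - ln 2) = 2 * pi * x2 by rewrite /x2; ring.
  by rewrite cosN; field.
have x1j : 0 <= x1 <= j%:R.
  rewrite /x1 mulr_ge0 ?divr_ge0 ?(ltW l2) ?(ltW lB0)//=.
  by rewrite ler_piMr ?(ltW jR)// ler_pdivrMr// mul1r.
have x2j : 0 <= x2 <= j%:R.
  rewrite /x2 mulr_ge0 ?divr_ge0 ?(ltW l32) ?(ltW lB0)//=.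
  by rewrite ler_piMr ?(ltW jR)// ler_pdivrMr// mul1r; lra.
have key : c1 / j%:R ^+ 16 <= `|e1| + `|e2|.
  (* If both nearest integers are 0 the linear form is empty, but then the distance e1 is x1 itself,
     at least log_B 2. *)
  have [/andP[/eqP z1 /eqP z2]|nz] := boolP ((m1 == 0) && (m2 == 0)).
    have -> : e1 = x1 by rewrite /e1 z1 subr0.
    apply: (@le_trans _ _ `|x1|); last by rewrite lerDl.
    apply: (@le_trans _ _ (ln 2 / ln B%:R)).
      rewrite ler_pdivrMr ?exprn_gt0//; apply: (@le_trans _ _ (ln 2 / ln B%:R)).
        by rewrite ge_min lexx orbT.
      by rewrite ler_peMr ?divr_ge0 ?(ltW l2) ?(ltW lB0)// exprn_ege1.
    apply: le_trans (ler_norm _); rewrite /x1 ler_peMl// divr_ge0 ?(ltW l2) ?(ltW lB0)//.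
  have nz' : (m2 - m1 != 0) || (m2 != 0).
    rewrite -negb_and; apply: contra nz => /andP[h /eqP h2].
    by move: h; rewrite h2 sub0r oppr_eq0 => ->; rewrite eqxx.
  have mb (m : int) (x : R) : 0 <= x <= j%:R -> `|x - m%:~R| <= 1 / 2 -> `|m%:~R : R| <= 2 * j%:R.
    move=> /andP[xa xb]; rewrite !ler_norml => /andP[ha hb]; apply/andP; split; lra.
  have b1 := mb _ _ x1j d1; have b2 := mb _ _ x2j d2.
  have H1 : 1 <= 4 * j%:R :> R by lra.
  have b3 : `|(m2 - m1)%:~R : R| <= 4 * j%:R.
    by rewrite rmorphB/=; apply: le_trans (ler_normB _ _) _; lra.
  have b4 : `|m2%:~R : R| <= 4 * j%:R by lra.
  have := form (m2 - m1) m2 (4 * j%:R) H1 nz' b3 b4.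
  (* Because x1 (ln 3 - ln 2) = x2 ln 2, the real parts cancel and only integer multiples of
     logarithms remain; ln 2 = (ln 3 - ln 2) + (ln 4 - ln 3) rewrites them in the basis of
     [log_form_lower_bound]. *)
  have -> : (m2 - m1)%:~R * (ln 3 - ln 2) + m2%:~R * (ln 4 - ln 3) =
      e1 * (ln 3 - ln 2) - e2 * ln 2 :> R.
    have xx : x1 * (ln 3 - ln 2) = x2 * ln 2 by rewrite /x1 /x2; ring.
    rewrite rmorphB/= l4 /e1 /e2 !mulrBl xx; ring.
  move=> h.
  apply: (@le_trans _ _ (c0 / (4 * j%:R) ^+ 16)).
    have -> : c0 / (4 * j%:R) ^+ 16 = c0 / 4 ^+ 16 / j%:R ^+ 16.
      by rewrite (exprMn 16 4 (j%:R : R)) invfM [LHS]mulrA.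
    rewrite ler_wpM2r ?invr_ge0 ?exprn_ge0//.
    by rewrite ge_min lexx.
  apply: (le_trans h); apply: le_trans (ler_normB _ _) _; rewrite !normrM.
  rewrite (gtr0_norm l32) (gtr0_norm l2); apply: lerD; rewrite ler_piMr//; lra.
rewrite phiE.
have : (c1 / j%:R ^+ 16) ^+ 2 <= (`|e1| + `|e2|) ^+ 2.
  rewrite lerXn2r ?nnegrE ?addr_ge0//.
  by rewrite divr_ge0 ?(ltW c10)// exprn_ge0.
have -> : (c1 / j%:R ^+ 16) ^+ 2 = c1 ^+ 2 / j%:R ^+ 32.
  by rewrite expr_div_n -exprM.
have -> : c1 ^+ 2 / 2 / j%:R ^+ 32 = c1 ^+ 2 / j%:R ^+ 32 / 2 by rewrite mulrAC.
have := sqr_ge0 (`|e1| - `|e2|).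
have n1 : `|e1| ^+ 2 = e1 ^+ 2 by rewrite real_normK ?num_real.
have n2 : `|e2| ^+ 2 = e2 ^+ 2 by rewrite real_normK ?num_real.
move: g1 g2 n1 n2; move: (`|e1|) (`|e2|) (_ / j%:R ^+ 32) => a b w.
have -> : (a - b) ^+ 2 = a ^+ 2 - 2 * (a * b) + b ^+ 2 by ring.
have -> : (a + b) ^+ 2 = a ^+ 2 + 2 * (a * b) + b ^+ 2 by ring.
move=> g1 g2 -> ->; lra.
Qed.

Lemma tsum_rot k th et (e : seq bool) :
  tsum cos k (th + et) e = cos et * tsum cos k th e - sin et * tsum sin k th e /\
  tsum sin k (th + et) e = sin et * tsum cos k th e + cos et * tsum sin k th e :> R.
Proof.
elim: e th => [|b e IH] th /=; first by split; ring.
rewrite addrAC; have [-> ->] := IH (th + k * step R b).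
by move: (th + k * step R b) => u; rewrite cosD sinD; split; ring.
Qed.

(** The starting angle only rotates the sum. This removes ln x_0, which varies within a block, and
    leaves a function of the parity vector. *)
Lemma tsum_sqr k th (e : seq bool) :
  tsum cos k th e ^+ 2 + tsum sin k th e ^+ 2 =
  tsum cos k 0 e ^+ 2 + tsum sin k 0 e ^+ 2 :> R.
Proof.
have [] := tsum_rot k 0 th e; rewrite add0r => -> ->.
have := cos2Dsin2 th.
move: (cos th) (sin th) (tsum cos k 0 e) (tsum sin k 0 e) => c s C S h.
transitivity ((c ^+ 2 + s ^+ 2) * (C ^+ 2 + S ^+ 2)); first ring.
by rewrite h mul1r.
Qed.

End Gap.

(** * Second moments of the Weyl sums over a block of 2^N integers *)

Section Blocks.
Variables (R : realType) (B : nat).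
Hypothesis B2 : (2 <= B)%N.

Let lB0 : 0 < ln B%:R :> R.
Proof. by rewrite ln_gt0// ltr1n. Qed.

Definition freq (j : nat) : R := 2 * pi * j%:R / ln B%:R.

Lemma freq_ge0 j : 0 <= freq j.
Proof. by rewrite divr_ge0 ?(ltW lB0)// mulr_ge0// mulr_ge0// pi_ge0. Qed.

Lemma weyl_sum_sqr_le N j (x : int) : 0 < x ->
  weyl_sum (log_iterates R B N x) j ^+ 2 <=
  2 * (tsum cos (freq j) 0 (parities N x) ^+ 2 + tsum sin (freq j) 0 (parities N x) ^+ 2)
  + 8 / 3 * N%:R ^+ 2 * freq j * zerr R (parities N x) / x%:~R.
Proof.
move=> x0; have xR : 0 < x%:~R :> R by rewrite ltr0z.
have aE (f : R -> R) : \sum_(y <- log_iterates R B N x) f (2 * pi * j%:R * y) =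
    asum (fun y => f (freq j * ln y%:~R)) N x.
  rewrite -asumE big_map; apply: eq_bigr => k _.
  by congr f; rewrite /freq /logB; ring.
rewrite /weyl_sum !aE sqr_sqrtr ?addr_ge0 ?sqr_ge0//.
set e := parities N x; set th := freq j * ln x%:~R.
rewrite -(tsum_sqr (freq j) th e).
have k0 := freq_ge0 j.
pose w : R := freq j * zerr R e / (3 * x%:~R).
have w0 : 0 <= w.
  apply: divr_ge0; last by rewrite mulr_ge0// ltW.
  exact: mulr_ge0 k0 (zerr_ge0 _ _).
have diff (f : R -> R) : (forall u v, `|f u - f v| <= `|u - v|) -> (forall u, `|f u| <= 1) ->
    asum (fun y => f (freq j * ln y%:~R)) N x ^+ 2 <=
    2 * tsum f (freq j) th e ^+ 2 + 4 * N%:R ^+ 2 * w.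
  move=> fL f1.
  have h0 : `|freq j * ln x%:~R - th| <= 0 by rewrite /th subrr normr0.
  have := asum_tsum_le N k0 x0 fL h0; rewrite add0r -/e -/w.
  have := asum_tsum_le2 (freq j) N x th f1; rewrite -/e.
  set A := asum _ _ _; set T := tsum _ _ _ _ => h2 h1.
  (* One factor |A - T| is bounded trivially and the other by the accumulated error, so [zerr]
     enters linearly and its mean suffices. *)
  have h3 : (A - T) ^+ 2 <= 2 * N%:R * (N%:R * w).
    rewrite -[leLHS]real_normK ?num_real// expr2.
    by apply: ler_pM.
  (* Equivalent to A^2 <= 2 T^2 + 2 (A - T)^2. *)
  have := sqr_ge0 (A - 2 * T).
  move: h3; have -> : 2 * N%:R * (N%:R * w) = 2 * N%:R ^+ 2 * w by ring.
  have -> : (A - T) ^+ 2 = A ^+ 2 - 2 * (A * T) + T ^+ 2 by ring.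
  have -> : (A - 2 * T) ^+ 2 = A ^+ 2 - 4 * (A * T) + 4 * T ^+ 2 by ring.
  lra.
have hc := diff _ (@cos_lipschitz R) (@cos_max R).
have hs := diff _ (@sin_lipschitz R) (@sin_max R).
have -> : 8 / 3 * N%:R ^+ 2 * freq j * zerr R e / x%:~R = 8 * N%:R ^+ 2 * w.
  by rewrite /w; field; rewrite gt_eqF.
lra.
Qed.

Local Opaque freq.

(** The restriction x >= 2^N / N replaces 1 / x by N / 2^N, so the bound depends on the parity
    vector only and [sum_parities] applies. The mean error (4/3)^N becomes N (2/3)^N. *)
Lemma block_sum_le N j (r : nat) : (0 < N)%N -> phi_re (freq j) < 1 ->
  \sum_(y < 2 ^ N) (2 ^ N <= N * (r + y))%N%:R *
     weyl_sum (log_iterates R B N (r + y)%N%:Z) j ^+ 2 <=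
  2 ^+ N * (12 * N%:R / (1 - phi_re (freq j)) + 8 * N%:R ^+ 3 * freq j * (2 / 3) ^+ N).
Proof.
move=> N0 p1; have NR : 0 < N%:R :> R by rewrite ltr0n.
have k0 := freq_ge0 j.
have P0 : 0 < 2 ^+ N :> R by rewrite exprn_gt0.
pose G (e : seq bool) : R := 2 * (tsum cos (freq j) 0 e ^+ 2 + tsum sin (freq j) 0 e ^+ 2)
  + 8 / 3 * N%:R ^+ 3 * freq j / 2 ^+ N * zerr R e.
have n3 : 0 <= N%:R ^+ 3 :> R by rewrite exprn_ge0.
have c0 : 0 <= 8 / 3 * N%:R ^+ 3 * freq j / 2 ^+ N :> R.
  apply: divr_ge0; last exact: ltW.
  by apply: mulr_ge0 => //; apply: mulr_ge0 => //; rewrite divr_ge0.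
have G0 e : 0 <= G e.
  apply: addr_ge0; last exact: mulr_ge0 c0 (zerr_ge0 _ _).
  by apply: mulr_ge0 => //; apply: addr_ge0; exact: sqr_ge0.
apply: (@le_trans _ _ (\sum_(y < 2 ^ N) G (parities N (r%:Z + 1 * y%:Z)))).
  apply: ler_sum => y _; rewrite mul1r -PoszD.
  have [h|h] := leqP (2 ^ N) (N * (r + y)); last by rewrite mul0r.
  rewrite mul1r.
  have x0 : (0 < r + y)%N.
    by rewrite lt0n; apply/eqP => E; move: h; rewrite E muln0 leqn0 expn_eq0.
  apply: le_trans (weyl_sum_sqr_le _ _ _) _; first by rewrite ltz_nat.
  rewrite lerD2l.
  have xR : 0 < (r + y)%N%:R :> R by rewrite ltr0n.
  have -> : 8 / 3 * N%:R ^+ 3 * freq j / 2 ^+ N * zerr R (parities N (r + y)%N) =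
    (8 / 3 * N%:R ^+ 2 * freq j * zerr R (parities N (r + y)%N)) * (N%:R / 2 ^+ N).
    by rewrite exprSr; ring.
  rewrite -pmulrn; apply: ler_wpM2l.
    apply: mulr_ge0 (zerr_ge0 _ _); apply: mulr_ge0 => //; apply: mulr_ge0.
      by rewrite divr_ge0.
    exact: sqr_ge0.
  rewrite ler_pdivlMr// mulrC ler_pdivrMr//.
  by rewrite -natrX -natrM ler_nat.
rewrite sum_parities// /G bsumD !bsumM.
have wsm := walk_second_moment N 0 p1; have bz := bsum_zerr R N.
have := ler_wpM2l c0 bz.
have -> : 8 / 3 * N%:R ^+ 3 * freq j / 2 ^+ N * (3 * (8 / 3) ^+ N) =
   2 ^+ N * (8 * N%:R ^+ 3 * freq j * (2 / 3) ^+ N).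
  have -> : 8 / 3 = 2 * 2 * (2 / 3) :> R by field.
  rewrite !(exprMn N) -[2 * 2 * (2 / 3)]/(2 * 2 * (2 / 3)).
  field; rewrite ?gt_eqF//.
have -> : 2 ^+ N * (12 * N%:R / (1 - phi_re (freq j)) + 8 * N%:R ^+ 3 * freq j * (2 / 3) ^+ N) =
  2 * (2 ^+ N * (6 * N%:R / (1 - phi_re (freq j)))) + 2 ^+ N * (8 * N%:R ^+ 3 * freq j * (2 / 3) ^+ N).
  by field; rewrite gt_eqF// subr_gt0.
lra.
Qed.

End Blocks.

Lemma sum_blocks (V : nmodType) (F : nat -> V) Q P :
  \sum_(x < Q * P) F x = \sum_(b < Q) \sum_(y < P) F (b * P + y)%N.
Proof.
elim: Q => [|Q IH]; first by rewrite mul0n !big_ord0.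
rewrite big_ord_recr/= -IH -!(big_mkord xpredT) mulSn addnC.
rewrite (@big_cat_nat _ _ _ (Q * P)) ?leq_addr//=; congr (_ + _).
rewrite -{1}[(Q * P)%N]add0n big_addn addKn -(big_mkord xpredT (fun y => F (Q * P + y)%N)).
by apply: eq_bigr => y _; rewrite addnC.
Qed.

(** * Chebyshev's inequality and the count of exceptional integers *)

Section Counting.
Variables (R : realType) (B : nat).

Lemma card_exceptional_le N (X : R) K : (X < K%:R) ->
  (#|` fset_set (exceptional B N X)|)%:R <=
  \sum_(x < K) `[< exceptional B N X x%:Z >]%:R :> R.
Proof.
move=> XK; have fin := finite_exceptional B N X.
pose P (x : nat) := `[< exceptional B N X x%:Z >].
apply: (@le_trans _ _ (size [seq Posz x | x <- iota 0 K & P x])%:R).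
  rewrite ler_nat; apply: uniq_leq_size; first exact: fset_uniq.
  move=> z; rewrite in_fset_set// inE => Ez.
  have [z1 zX _] := Ez.
  case: z Ez z1 zX => [n|//] Ez z1 zX; apply/mapP; exists n => //.
  rewrite mem_filter mem_iota /= add0n; apply/andP; split; first exact/asboolP.
  by rewrite -(ltr_nat R); apply: le_lt_trans XK.
rewrite size_map size_filter -sum1_count natr_sum big_mkcond/=.
rewrite -(big_mkord xpredT (fun x => (P x)%:R)) /index_iota subn0 le_eqVlt.
by apply/orP; left; apply/eqP; apply: eq_bigr => x _; case: (P x).
Qed.

Lemma sum_small_le N K : (0 < N)%N ->
  \sum_(x < K) ((0 < x) && (N * x < 2 ^ N))%N%:R <= 2 ^+ N / N%:R :> R.
Proof.
move=> N0; pose m := (2 ^ N %/ N)%N.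
apply: (@le_trans _ _ m%:R); last first.
  by rewrite ler_pdivlMr ?ltr0n// -natrX -natrM ler_nat leq_trunc_div.
rewrite -natr_sum ler_nat.
apply: (@leq_trans (\sum_(x < K) (0 < x <= m)%N)%N).
  apply: leq_sum => x _.
  case: (boolP ((0 < x) && (N * x < 2 ^ N))%N) => // /andP[x0 h].
  have xm : (x <= m)%N by rewrite /m leq_divRL// mulnC ltnW.
  by rewrite x0 xm.
rewrite -(big_mkord xpredT (fun x => nat_of_bool (0 < x <= m)%N)).
rewrite -big_mkcond/= sum1_count -size_filter -[X in (_ <= X)%N](size_iota 1 m).
apply: uniq_leq_size; first by rewrite filter_uniq// iota_uniq.
by move=> x; rewrite mem_filter mem_iota add1n ltnS => /andP[].
Qed.

(** Pointwise Chebyshev inequality: for x >= 2^N / N a large discrepancy forces nu^2 / N^2 times the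
    sum of the squared Weyl sums above 9/128, and 15 exceeds 128/9. *)
Lemma bad_indicator N (X nu : R) J (x : nat) : (0 < N)%N -> (1 < J)%N ->
  0 < nu -> 100 * nu <= J%:R -> N%:R `^ (- (1 / 36)) = nu^-1 ->
  `[< exceptional B N X x%:Z >]%:R <= ((0 < x) && (N * x < 2 ^ N))%N%:R +
  15 * nu ^+ 2 / N%:R ^+ 2 * \sum_(j < J) (2 ^ N <= N * x)%N%:R *
      weyl_sum (log_iterates R B N x%:Z) j.+1 ^+ 2 :> R.
Proof.
move=> N0 J1 nu0 nuJ nuE; have NR : 0 < N%:R :> R by rewrite ltr0n.
have JR : 0 < J%:R :> R by rewrite ltr0n ltnW.
have c0 : 0 <= 15 * nu ^+ 2 / N%:R ^+ 2.
  by apply: divr_ge0; [apply: mulr_ge0 => //|]; exact: sqr_ge0.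
have s0 : 0 <= \sum_(j < J) (2 ^ N <= N * x)%N%:R *
      weyl_sum (log_iterates R B N x%:Z) j.+1 ^+ 2 :> R.
  by rewrite sumr_ge0// => j _; rewrite mulr_ge0// sqr_ge0.
case: asboolP => [[x1 _ Dx]|_]; last by rewrite addr_ge0// mulr_ge0.
have x0 : (0 < x)%N by rewrite -ltz_nat.
rewrite x0/=; case: ltnP => h.
  rewrite lerDl; apply: mulr_ge0 => //.
  by rewrite sumr_ge0// => j _; rewrite mulr_ge0// sqr_ge0.
rewrite add0r; under eq_bigr do rewrite mul1r.
set Y := log_iterates R B N x%:Z in Dx *.
have szY : size Y = N by rewrite size_map size_iota.
have ET := @erdos_turan R Y J J1; rewrite szY in ET; have {}ET := ET N0.
rewrite nuE in Dx.
have h1 : 100 / J%:R <= nu^-1 by rewrite ler_pdivrMr// mulrC ler_pdivlMr.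
pose w (j : nat) : R := weyl_sum Y j.+1 / N%:R; pose v (j : nat) : R := j.+1%:R^-1.
have hv : \sum_(j < J) v j ^+ 2 <= 2.
  have hh : \sum_(2 <= s < J.+1) (s%:R ^+ 2)^-1 <= 1 :> R.
    by apply: le_trans (@sum_inv_sqr_le R 1 J.+1 isT) _; lra.
  rewrite -(big_mkord xpredT (fun j => v j ^+ 2)) big_ltn; last by rewrite ltnW.
  have -> : v 0%N ^+ 2 = 1 by first [by rewrite /v invr1 expr1n | by rewrite /v; field | by rewrite /v; lra].
  have : \sum_(1 <= i < J) v i ^+ 2 <= 1.
    apply: le_trans hh; rewrite (big_add1 _ _ 1 J.+1)/=.
    by rewrite le_eqVlt; apply/orP; left; apply/eqP; apply: eq_bigr => i _; rewrite /v exprVn.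
  lra.
have hwv : 3 / 8 * nu^-1 < \sum_(j < J) w j * v j.
  have -> : \sum_(j < J) w j * v j = \sum_(j < J) weyl_sum Y j.+1 / j.+1%:R / N%:R.
    by apply: eq_bigr => j _; rewrite /w /v mulrAC.
  lra.
(* Weighted arithmetic-geometric mean. As the v_j^2 sum to at most 2, the second part is at most
   3/16 nu^-1, half of the lower bound in [hwv]. *)
have am : \sum_(j < J) w j * v j <= 8 / 3 * nu * (\sum_(j < J) w j ^+ 2) +
     3 / 32 * nu^-1 * (\sum_(j < J) v j ^+ 2).
  rewrite !mulr_sumr -big_split/=; apply: ler_sum => j _.
  have := sqr_ge0 (16 / 3 * nu * w j - v j) => hq.
  have : 0 <= 3 / 32 * nu^-1 * (16 / 3 * nu * w j - v j) ^+ 2.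
    by rewrite mulr_ge0// mulr_ge0 ?divr_ge0 ?invr_ge0// ltW.
  have -> : 3 / 32 * nu^-1 * (16 / 3 * nu * w j - v j) ^+ 2 =
    8 / 3 * nu * w j ^+ 2 + 3 / 32 * nu^-1 * v j ^+ 2 - w j * v j.
    by field; rewrite gt_eqF.
  by rewrite subr_ge0.
have nuV : 0 < nu^-1 by rewrite invr_gt0.
have hv' : 3 / 32 * nu^-1 * (\sum_(j < J) v j ^+ 2) <= 3 / 16 * nu^-1.
  have -> : 3 / 16 * nu^-1 = 3 / 32 * nu^-1 * 2 by field; rewrite gt_eqF.
  by rewrite ler_wpM2l// mulr_ge0 ?divr_ge0// ltW.
have fin : 3 / 16 * nu^-1 < 8 / 3 * nu * (\sum_(j < J) w j ^+ 2) by lra.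
have wE : \sum_(j < J) w j ^+ 2 = (\sum_(j < J) weyl_sum Y j.+1 ^+ 2) / N%:R ^+ 2.
  by rewrite mulr_suml; apply: eq_bigr => j _; rewrite /w expr_div_n.
rewrite wE in fin; move: fin.
set S := \sum_(j < J) weyl_sum Y j.+1 ^+ 2.
have S0 : 0 <= S / N%:R ^+ 2.
  by rewrite divr_ge0 ?sqr_ge0// sumr_ge0// => j _; exact: sqr_ge0.
have -> : 15 * nu ^+ 2 / N%:R ^+ 2 * S = 15 * nu ^+ 2 * (S / N%:R ^+ 2) by ring.
move: (S / _) S0 => T T0 fin.
have := ltW fin; rewrite -(ler_pM2l nu0).
have -> : nu * (3 / 16 * nu^-1) = 3 / 16 by field; rewrite gt_eqF.
have -> : nu * (8 / 3 * nu * T) = 8 / 3 * (nu ^+ 2 * T) by ring.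
have := mulr_ge0 (sqr_ge0 nu) T0; lra.
Qed.

End Counting.

Theorem theorem2p1 (R : realType) (B : nat) (hB : (2 <= B)%N) :
  exists c : R, 0 < c /\
    forall (N : nat) (X : R), (1 <= N)%N -> 2 ^+ N <= X ->
      (#|` fset_set (exceptional B N X)|)%:R <= c * N%:R `^ (- (1 / 36)) * X
      /\ (forall x0 : int, 1 <= x0 -> x0%:~R <= X ->
            ~ exceptional B N X x0 ->
            discrepancy (log_iterates R B N x0) <= 2 * N%:R `^ (- (1 / 36))).
Proof.
have [cg cg0 gap] := @phi_gap R B hB.
have [C3 C30 hC3] := @natX_geom_bounded R (2 / 3) 3 ltac:(lra) ltac:(lra).
have lB0 : 0 < ln B%:R :> R by rewrite ln_gt0// ltr1n.
(* 360 = 15 * 2 * 12 and 1920 = 15 * 2 * 8 * 8: the 15 of [bad_indicator], the 2 of the cover by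
   blocks, the constants of [block_sum_le], and 8 as a bound for 2 pi. *)
pose c1 : R := 360 * 101 ^+ 33 / cg; pose c2 : R := 1920 / ln B%:R * 101 ^+ 2 * C3.
have c10 : 0 <= c1 by apply: divr_ge0 (ltW cg0); rewrite mulr_ge0// exprn_ge0.
have c20 : 0 <= c2.
  by apply: mulr_ge0 (ltW C30); apply: mulr_ge0 (sqr_ge0 _); rewrite divr_ge0// ltW.
exists (1 + c1 + c2); split; first by lra.
move=> N X N1 XN; split; last first.
  by move=> x0 x1 xX nE; rewrite leNgt; apply/negP => h; apply: nE.
have NR : 0 < N%:R :> R by rewrite ltr0n.
have NR1 : 1 <= N%:R :> R by rewrite ler1n.
pose nu : R := N%:R `^ (1 / 36).
have nu_ge0 : 0 <= nu by exact: powR_ge0.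
have nu36 : nu ^+ 36 = N%:R.
  rewrite -powR_mulrn// /nu -powRrM (_ : 1 / 36 * 36%:R = 1 :> R) ?powRr1//; by field.
have nu1 : 1 <= nu.
  rewrite leNgt; apply/negP => h; have := exprn_ilt1 36 nu_ge0 h.
  by rewrite nu36 ltNge NR1.
have nu0 : 0 < nu by apply: lt_le_trans nu1.
have nuE : N%:R `^ (- (1 / 36)) = nu^-1 :> R by rewrite powRN.
rewrite nuE.
have nu100 : 0 <= 100 * nu by rewrite mulr_ge0.
(* This makes the term 100 / J of the Erdos-Turan inequality at most half of the threshold 2 /
   nu. *)
pose J := (Num.truncn (100 * nu)).+1.
have nuJ : 100 * nu <= J%:R by apply: ltW; exact: truncnS_gt.
have J101 : J%:R <= 101 * nu.
  have /andP[h _] := truncn_itv nu100.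
  by rewrite /J -natr1; lra.
have JR : 0 < J%:R :> R by rewrite ltr0n.
have J1 : (1 < J)%N.
  by rewrite -(ltr_nat R); apply: lt_le_trans nuJ; lra.
have P0 : 0 < 2 ^+ N :> R by rewrite exprn_gt0.
have X0 : 0 < X := lt_le_trans P0 XN.
have XP0 : 0 <= X / 2 ^+ N by rewrite divr_ge0 ?(ltW X0) ?(ltW P0).
(* Enough blocks to cover [0, X]; since X >= 2^N they contain at most 2 X integers. *)
pose Q := (Num.truncn (X / 2 ^+ N)).+1.
have QX : X < (Q * 2 ^ N)%N%:R.
  by rewrite natrM natrX -ltr_pdivrMr//; exact: truncnS_gt.
have Q2X : (Q * 2 ^ N)%N%:R <= 2 * X.
  have /andP[h _] := truncn_itv XP0.
  rewrite natrM natrX /Q -natr1 mulrDl mul1r -[X in _ <= 2 * X](@divfK _ (2 ^+ N)) ?gt_eqF//.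
  have := ler_wpM2r (ltW P0) h; rewrite divfK ?gt_eqF// => h'; lra.
pose W (j x : nat) : R := (2 ^ N <= N * x)%N%:R * weyl_sum (log_iterates R B N x%:Z) j.+1 ^+ 2.
pose c15 : R := 15 * nu ^+ 2 / N%:R ^+ 2.
have c150 : 0 <= c15 by apply: divr_ge0; [apply: mulr_ge0 => //|]; exact: sqr_ge0.
pose T : R := 12 * N%:R * (J%:R ^+ 32 / cg) + 8 * N%:R ^+ 3 * (8 * J%:R / ln B%:R) * (2 / 3) ^+ N.
have Wle (j : 'I_J) : \sum_(x < Q * 2 ^ N) W j x <= (Q * 2 ^ N)%N%:R * T.
  rewrite sum_blocks natrM natrX -mulrA -[Q in Q%:R]card_ord mulr_natl -sumr_const.
  apply: ler_sum => b _.
  have j0 : 0 < j.+1%:R :> R by [].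
  have jJ : j.+1%:R <= J%:R :> R by rewrite ler_nat.
  have g := gap j.+1 isT; rewrite -/(freq R B j.+1) in g.
  have g0 : 0 < cg / j.+1%:R ^+ 32 by rewrite divr_gt0// exprn_gt0.
  have p0 : 0 < 1 - phi_re (freq R B j.+1) by apply: lt_le_trans g.
  have p1 : phi_re (freq R B j.+1) < 1 by rewrite -subr_gt0.
  apply: le_trans (block_sum_le hB (b * 2 ^ N) N1 p1) _.
  rewrite ler_wpM2l ?(ltW P0)//; apply: lerD.
    apply: ler_wpM2l; first by rewrite mulr_ge0.
    apply: (@le_trans _ _ (j.+1%:R ^+ 32 / cg)).
      have -> : j.+1%:R ^+ 32 / cg = (cg / j.+1%:R ^+ 32)^-1 by rewrite invf_div.
      by rewrite lef_pV2 ?posrE.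
    by rewrite ler_wpM2r ?invr_ge0 ?(ltW cg0)// lerXn2r ?nnegrE.
  have t0 : 0 <= (2 / 3) ^+ N :> R by rewrite exprn_ge0// divr_ge0.
  rewrite ler_wpM2r// ler_wpM2l ?mulr_ge0 ?exprn_ge0//.
  rewrite /freq ler_wpM2r ?invr_ge0 ?(ltW lB0)//.
  have pi4 := pihalf_lt2 R; have pi0 := pi_ge0 R.
  by apply: ler_pM; rewrite ?mulr_ge0//; lra.
have cardle : (#|` fset_set (exceptional B N X)|)%:R <=
    2 ^+ N / N%:R + c15 * (J%:R * ((Q * 2 ^ N)%N%:R * T)).
  apply: le_trans (card_exceptional_le B N QX) _.
  apply: (@le_trans _ _ (\sum_(x < Q * 2 ^ N) (((0 < x) && (N * x < 2 ^ N))%N%:R +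
      c15 * \sum_(j < J) W j x))).
    by apply: ler_sum => x _; rewrite /c15 /W; apply: bad_indicator.
  rewrite big_split/= -mulr_sumr; apply: lerD; first by apply: sum_small_le.
  rewrite ler_wpM2l// exchange_big/= -[J in J%:R]card_ord mulr_natl -sumr_const.
  by apply: ler_sum => j _.
apply: (le_trans cardle).
have nuV0 : 0 < nu^-1 by rewrite invr_gt0.
have NV : N%:R^-1 <= nu^-1.
  by rewrite lef_pV2 ?posrE// -nu36 exprS ler_peMr// exprn_ege1.
have cgV : 0 <= cg^-1 by rewrite invr_ge0 ltW.
have lBV : 0 <= (ln B%:R)^-1 :> R by rewrite invr_ge0 ltW.
have t0 : 0 <= (2 / 3) ^+ N :> R by rewrite exprn_ge0// divr_ge0.
have term0 : 2 ^+ N / N%:R <= X * nu^-1 by apply: ler_pM; rewrite ?(ltW P0) ?invr_ge0.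
have T0 : 0 <= T.
  apply: addr_ge0; first by rewrite !mulr_ge0// exprn_ge0.
  by rewrite !mulr_ge0// exprn_ge0.
have step1 : c15 * (J%:R * ((Q * 2 ^ N)%N%:R * T)) <= c15 * (J%:R * (2 * X * T)).
  by rewrite ler_wpM2l// ler_wpM2l// ler_wpM2r.
have splitT : c15 * (J%:R * (2 * X * T)) = X * (360 * (nu ^+ 2 * J%:R ^+ 33 / N%:R) / cg +
    1920 / ln B%:R * (nu ^+ 2 * J%:R ^+ 2 * (N%:R * (2 / 3) ^+ N))).
  rewrite /c15 /T (exprS _ 32); move: (J%:R ^+ 32) ((2 / 3) ^+ N) => a b.
  by field; rewrite !gt_eqF.
(* The balance that fixes the exponent: J^32 from the gap, one more J from the number of
   frequencies, nu^2 from Chebyshev, against N = nu^36. *)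
have J33 : nu ^+ 2 * J%:R ^+ 33 / N%:R <= 101 ^+ 33 * nu^-1.
  rewrite ler_pdivrMr// -nu36.
  have -> : 101 ^+ 33 * nu^-1 * nu ^+ 36 = nu ^+ 2 * (101 ^+ 33 * nu ^+ 33).
    rewrite (exprS nu 35) (exprD nu 2 33); move: (101 ^+ 33) (nu ^+ 33) => a b.
    by field; rewrite gt_eqF.
  rewrite -(exprMn 33 101 nu) ler_wpM2l ?sqr_ge0//.
  by rewrite lerXn2r ?nnegrE ?mulr_ge0.
have nu4 : nu ^+ 4 <= N%:R by rewrite -nu36 ler_weXn2l.
(* [C3] bounds N^3 (2/3)^N, so the second power of N leaves a factor 1 / N, at most nu^-1. *)
have N2 : N%:R * (N%:R * (2 / 3) ^+ N) <= C3 * nu^-1.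
  apply: (@le_trans _ _ (C3 * N%:R^-1)); last by rewrite ler_wpM2l ?(ltW C30).
  rewrite ler_pdivlMr//; apply: le_trans (hC3 N).
  by rewrite le_eqVlt; apply/orP; left; apply/eqP; ring.
have J2 : nu ^+ 2 * J%:R ^+ 2 * (N%:R * (2 / 3) ^+ N) <= 101 ^+ 2 * (C3 * nu^-1).
  have b0 : 0 <= N%:R * (2 / 3) ^+ N :> R by rewrite mulr_ge0.
  apply: (@le_trans _ _ (101 ^+ 2 * (N%:R * (N%:R * (2 / 3) ^+ N)))); last first.
    by rewrite ler_wpM2l ?exprn_ge0.
  rewrite [leRHS]mulrA ler_wpM2r//.
  apply: (@le_trans _ _ (nu ^+ 2 * (101 * nu) ^+ 2)).
    by rewrite ler_wpM2l ?sqr_ge0// lerXn2r ?nnegrE ?mulr_ge0.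
  have -> : nu ^+ 2 * (101 * nu) ^+ 2 = 101 ^+ 2 * nu ^+ 4 by ring.
  by rewrite ler_wpM2l ?exprn_ge0.
have A1 : 360 * (nu ^+ 2 * J%:R ^+ 33 / N%:R) / cg <= c1 * nu^-1.
  have -> : c1 * nu^-1 = 360 * (101 ^+ 33 * nu^-1) / cg.
    by rewrite /c1; move: (101 ^+ 33) => a; ring.
  by rewrite ler_wpM2r// ler_wpM2l.
have A2 : 1920 / ln B%:R * (nu ^+ 2 * J%:R ^+ 2 * (N%:R * (2 / 3) ^+ N)) <= c2 * nu^-1.
  have -> : c2 * nu^-1 = 1920 / ln B%:R * (101 ^+ 2 * (C3 * nu^-1)).
    by rewrite /c2; move: (101 ^+ 2) => a; ring.
  by rewrite ler_wpM2l// mulr_ge0.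
have -> : (1 + c1 + c2) * nu^-1 * X = X * nu^-1 + X * (c1 * nu^-1 + c2 * nu^-1) by ring.
apply: lerD => //; apply: (le_trans step1); rewrite splitT ler_wpM2l ?(ltW X0)//.
exact: lerD.
Qed.
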